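(* Let $I_1,I_2\subset\mathbf{R}$ be open intervals, let $\gamma=(\gamma_1,\gamma_2):I_1\to S^3$ be a unit speed Legendre curve in $S^3$ and $\alpha=(\alpha_1,\alpha_2):I_2\to H^3_1$ a unit speed Legendre curve in $H^3_1$, such that the map $$\phi:I_2\times I_1\to\mathbf{C}^2,\qquad \phi(t,s)=(\alpha_1(t)\gamma_1(s),\,\alpha_2(t)\gamma_2(s)),$$ is a (Lagrangian conformal) immersion. Then $\phi$ is Hamiltonian-minimal if and only if the curvature functions $k_\alpha$ and $k_\gamma$ of $\alpha$ and $\gamma$ are given by $$k_\alpha(t)=at+b\quad\text{and}\quad k_\gamma(s)=-as+c$$ for some $a,b,c\in\mathbf{R}$.
   Context: Curves are smooth. $S^3=\{(z,w)\in\mathbf{C}^2:|z|^2+|w|^2=1\}$. A unit speed Legendre curve $\gamma$ in $S^3$ satisfies $|\gamma_1|^2+|\gamma_2|^2=1$, $|\gamma_1'|^2+|\gamma_2'|^2=1$, $\gamma_1'\bar\gamma_1+\gamma_2'\bar\gamma_2=0$. $H^3_1=\{(z,w)\in\mathbf{C}^2:|z|^2-|w|^2=-1\}$. A unit speed Legendre curve $\alpha$ in $H^3_1$ satisfies $|\alpha_1|^2-|\alpha_2|^2=-1$, $|\alpha_1'|^2-|\alpha_2'|^2=1$, $\alpha_1'\bar\alpha_1-\alpha_2'\bar\alpha_2=0$. The curvature functions are the signed curvatures $k_\gamma=\mathrm{Re}\big(\gamma_1''\overline{i\gamma_1'}+\gamma_2''\overline{i\gamma_2'}\big)$ and $k_\alpha=\mathrm{Re}\big(\alpha_1''\overline{i\alpha_1'}-\alpha_2''\overline{i\alpha_2'}\big)$;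 equivalently they are the real functions with $\gamma''-ik_\gamma\gamma'+\gamma=0$ and $\alpha''-ik_\alpha\alpha'-\alpha=0$. The metric induced by $\phi$ from the Euclidean metric is $(|\gamma_1|^2+|\alpha_1|^2)(dt^2+ds^2)$, so $\phi$ is an immersion exactly when $|\gamma_1(s)|^2+|\alpha_1(t)|^2\neq0$ everywhere. A Lagrangian surface is Hamiltonian-minimal if it is a critical point of the area functional with respect to variations by compactly supported Hamiltonian vector fields. By a known characterization, this holds if and only if the Lagrangian angle map $\beta_\phi$ is harmonic, $\Delta\beta_\phi=0$, where $\Delta$ is the Laplacian of the induced metric and $\beta_\phi$ (with values in $\mathbf{R}/2\pi\mathbf{Z}$) is defined by $e^{i\beta_\phi}=\det_{\mathbf{C}}(\phi_*e_1,\phi_*e_2)$ for any oriented orthonormal basis $e_1,e_2$ of the surface. *)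

(* Defs.v *)
From Stdlib Require Import Reals.
From Coquelicot Require Import Coquelicot.

Local Open Scope R_scope.

Definition is_open_interval (I : R -> Prop) : Prop :=
  exists a b : Rbar,
    Rbar_lt a b /\ forall x : R, I x <-> Rbar_lt a x /\ Rbar_lt x b.

(** ** Complex-valued functions of a real variable

    Curves on an open interval [I] are represented by total functions on [R];
    only their values on [I] matter, since differentiation is local. *)

Definition CDerive (f : R -> C) (x : R) : C :=
  (Derive (fun y => Re (f y)) x, Derive (fun y => Im (f y)) x).

Definition smooth_curve (I : R -> Prop) (f : R -> C) : Prop :=
  forall (n : nat) (x : R), I x ->
    ex_derive_n (fun y => Re (f y)) n x /\ ex_derive_n (fun y => Im (f y)) n x.

(** ** Legendre curves in the 3-sphere and in the anti-de Sitter 3-space *)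

Definition unit_legendre_S3 (I : R -> Prop) (g1 g2 : R -> C) : Prop :=
  smooth_curve I g1 /\ smooth_curve I g2 /\
  forall s, I s ->
    Cmod (g1 s) ^ 2 + Cmod (g2 s) ^ 2 = 1 /\
    Cmod (CDerive g1 s) ^ 2 + Cmod (CDerive g2 s) ^ 2 = 1 /\
    (CDerive g1 s * Cconj (g1 s) + CDerive g2 s * Cconj (g2 s))%C = RtoC 0.

Definition unit_legendre_H31 (I : R -> Prop) (a1 a2 : R -> C) : Prop :=
  smooth_curve I a1 /\ smooth_curve I a2 /\
  forall t, I t ->
    Cmod (a1 t) ^ 2 - Cmod (a2 t) ^ 2 = -1 /\
    Cmod (CDerive a1 t) ^ 2 - Cmod (CDerive a2 t) ^ 2 = 1 /\
    (CDerive a1 t * Cconj (a1 t) - CDerive a2 t * Cconj (a2 t))%C = RtoC 0.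

Definition curvature_S3 (g1 g2 : R -> C) (s : R) : R :=
  Re (CDerive (CDerive g1) s * Cconj (Ci * CDerive g1 s)
      + CDerive (CDerive g2) s * Cconj (Ci * CDerive g2 s))%C.

Definition curvature_H31 (a1 a2 : R -> C) (t : R) : R :=
  Re (CDerive (CDerive a1) t * Cconj (Ci * CDerive a1 t)
      - CDerive (CDerive a2) t * Cconj (Ci * CDerive a2 t))%C.

(** ** The complex plane C^2 as a real Euclidean space *)

Definition C2 : Type := (C * C)%type.

Definition C2add (v w : C2) : C2 := ((fst v + fst w)%C, (snd v + snd w)%C).

Definition C2scal (r : R) (v : C2) : C2 :=
  ((RtoC r * fst v)%C, (RtoC r * snd v)%C).

Definition C2zero : C2 := (RtoC 0, RtoC 0).

Definition J (v : C2) : C2 := ((Ci * fst v)%C, (Ci * snd v)%C).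

Definition dot (v w : C2) : R :=
  Re (fst v * Cconj (fst w) + snd v * Cconj (snd w))%C.

Definition omega (v w : C2) : R := dot (J v) w.

(** ** Parametrized surfaces in C^2 *)

Definition C2Derive (f : R -> C2) (x : R) : C2 :=
  (CDerive (fun y => fst (f y)) x, CDerive (fun y => snd (f y)) x).

Definition pd1 (phi : R -> R -> C2) (t s : R) : C2 :=
  C2Derive (fun x => phi x s) t.

Definition pd2 (phi : R -> R -> C2) (t s : R) : C2 :=
  C2Derive (fun y => phi t y) s.

Definition immersion (I I' : R -> Prop) (phi : R -> R -> C2) : Prop :=
  forall t s, I t -> I' s -> forall x y : R,
    C2add (C2scal x (pd1 phi t s)) (C2scal y (pd2 phi t s)) = C2zero ->
    x = 0 /\ y = 0.

Definition lagrangian (I I' : R -> Prop) (phi : R -> R -> C2) : Prop :=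
  forall t s, I t -> I' s -> omega (pd1 phi t s) (pd2 phi t s) = 0.

(** Coefficients of the induced metric [E dt^2 + 2 F dt ds + G ds^2]. *)
Definition gE (phi : R -> R -> C2) (t s : R) : R := dot (pd1 phi t s) (pd1 phi t s).
Definition gF (phi : R -> R -> C2) (t s : R) : R := dot (pd1 phi t s) (pd2 phi t s).
Definition gG (phi : R -> R -> C2) (t s : R) : R := dot (pd2 phi t s) (pd2 phi t s).
Definition gdet (phi : R -> R -> C2) (t s : R) : R :=
  gE phi t s * gG phi t s - gF phi t s ^ 2.

Definition area (phi : R -> R -> C2) (t0 t1 s0 s1 : R) : R :=
  RInt (fun t => RInt (fun s => sqrt (gdet phi t s)) s0 s1) t0 t1.

(** ** Smooth real functions of two variables *)

Definition D1 (f : R -> R -> R) (t s : R) : R := Derive (fun x => f x s) t.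
Definition D2 (f : R -> R -> R) (t s : R) : R := Derive (fun y => f t y) s.

Fixpoint Ck2 (n : nat) (I I' : R -> Prop) (f : R -> R -> R) : Prop :=
  (forall t s, I t -> I' s -> continuity_2d_pt f t s) /\
  match n with
  | O => True
  | S m =>
      (forall t s, I t -> I' s ->
         ex_derive (fun x => f x s) t /\ ex_derive (fun y => f t y) s) /\
      Ck2 m I I' (D1 f) /\ Ck2 m I I' (D2 f)
  end.

Definition smooth2 (I I' : R -> Prop) (f : R -> R -> R) : Prop :=
  forall n : nat, Ck2 n I I' f.

(** ** Hamiltonian minimality *)

(** Image under the differential of [phi] of the gradient of [f] for the
    induced metric: [g^{ij} (d_j f) (d_i phi)]. *)
Definition grad (phi : R -> R -> C2) (f : R -> R -> R) (t s : R) : C2 :=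
  C2add
    (C2scal ((gG phi t s * D1 f t s - gF phi t s * D2 f t s) / gdet phi t s)
       (pd1 phi t s))
    (C2scal ((gE phi t s * D2 f t s - gF phi t s * D1 f t s) / gdet phi t s)
       (pd2 phi t s)).

Definition hamiltonian_field (phi : R -> R -> C2) (f : R -> R -> R) (t s : R) : C2 :=
  J (grad phi f t s).

Definition variation (phi xi : R -> R -> C2) (eps : R) (t s : R) : C2 :=
  C2add (phi t s) (C2scal eps (xi t s)).

(** A subset of [I x I'] has compact closure in it exactly when it lies in a
    rectangle [[t0,t1] x [s0,s1]] with endpoints in [I] and [I'].  The total
    area of the surface may be infinite; since [f] vanishes off the rectangle,
    the variation is constant there, and only the area over the rectangle
    varies. *)
Definition hamiltonian_minimal (I I' : R -> Prop) (phi : R -> R -> C2) : Prop :=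
  immersion I I' phi /\ lagrangian I I' phi /\
  forall (f : R -> R -> R) (t0 t1 s0 s1 : R),
    I t0 -> I t1 -> t0 <= t1 -> I' s0 -> I' s1 -> s0 <= s1 ->
    smooth2 I I' f ->
    (forall t s, ~ (t0 <= t <= t1 /\ s0 <= s <= s1) -> f t s = 0) ->
    is_derive
      (fun eps => area (variation phi (hamiltonian_field phi f) eps) t0 t1 s0 s1)
      0 0.

Definition product_surface (a1 a2 g1 g2 : R -> C) (t s : R) : C2 :=
  ((a1 t * g1 s)%C, (a2 t * g2 s)%C).

(* Main.v *)
Require Import Defs.
From Stdlib Require Import Reals Lra Lia Psatz Factorial.
From Coquelicot Require Import Coquelicot.

Local Open Scope R_scope.

(** Write X(t, s) = (a1(t) g1(s), a2(t) g2(s)) for the product surface, <,> for the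
    Euclidean inner product of C^2 and J for multiplication by i.

    A unit speed Legendre curve satisfies a linear equation of second order,
    a'' = i k_a a' + a in the anti-de Sitter space and g'' = i k_g g' - g in the
    sphere, since the curve and its velocity form a frame, orthonormal up to signs
    ([legendre_equation]). Hence X is conformal and Lagrangian, and the terms without
    derivatives cancel in X_tt + X_ss = J (k_a X_t + k_g X_s)
    ([product_laplacian]): the Lagrangian angle has differential k_a dt + k_g ds.

    For the variation field V = J grad f the derivative of the area density is
    <X_t, V_t> + <X_s, V_s> ([first_variation_conformal]). As V is normal, this is
    - <X_tt + X_ss, V>, which equals - (k_a f_t + k_g f_s)
    ([hamiltonian_first_variation]). Integrating by parts, the first variation of
    the area is the double integral of f (k_a' + k_g') ([double_integral_by_parts]).
    If the curvatures are affine with opposite slopes, it vanishes. Conversely,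
    testing with products of smooth bumps gives k_a'(t) + k_g'(s) = 0 for all t and s
    ([double_fundamental_lemma]), so each of the two terms is constant.

    The area is differentiated under the integral sign by a direct estimate: the Gram
    determinant of the varied surface is a polynomial in the
    parameter, so its square root has a first order expansion whose remainder is
    bounded uniformly on the compact rectangle ([sqrt_taylor],
    [is_derive_double_integral]). *)

(** * Functions of class C^n on an open rectangle *)

Lemma open_interval_locally (I : R -> Prop) (x : R) :
  is_open_interval I -> I x -> locally x I.
Proof.
  intros [a [b [_ H]]] Hx.
  apply H in Hx. destruct Hx as [Ha Hb].
  generalize (filter_and _ _ (open_Rbar_gt' _ _ Ha) (open_Rbar_lt' _ _ Hb)).
  apply filter_imp. intros y Hy. now apply H.
Qed.

Lemma open_interval_between (I : R -> Prop) (x y z : R) :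
  is_open_interval I -> I x -> I y -> x <= z <= y -> I z.
Proof.
  intros [a [b [_ H]]] Hx Hy Hz.
  apply H in Hx. apply H in Hy. apply H. split.
  - apply Rbar_lt_le_trans with x; [apply Hx | simpl; lra].
  - apply Rbar_le_lt_trans with y; [simpl; lra | apply Hy].
Qed.

Lemma locally_2d_open (I I' : R -> Prop) (P : R -> R -> Prop) (t s : R) :
  is_open_interval I -> is_open_interval I' -> I t -> I' s ->
  (forall u v, I u -> I' v -> P u v) -> locally_2d P t s.
Proof.
  intros hI hI' Ht Hs HP.
  destruct (open_interval_locally I t hI Ht) as [d Hd].
  destruct (open_interval_locally I' s hI' Hs) as [d' Hd'].
  exists (mkposreal _ (Rmin_stable_in_posreal d d')). simpl.
  intros u v Hu Hv. apply HP.
  - apply Hd. apply Rlt_le_trans with (1 := Hu), Rmin_l.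
  - apply Hd'. apply Rlt_le_trans with (1 := Hv), Rmin_r.
Qed.

Lemma continuity_2d_pt_fst_of (f : R -> R) (t s : R) :
  continuous f t -> continuity_2d_pt (fun u _ => f u) t s.
Proof.
  intros H. apply (continuity_1d_2d_pt_comp f (fun u _ => u));
    [|apply continuity_2d_pt_id1].
  now apply continuity_pt_filterlim.
Qed.

Lemma continuity_2d_pt_snd_of (f : R -> R) (t s : R) :
  continuous f s -> continuity_2d_pt (fun _ v => f v) t s.
Proof.
  intros H. apply (continuity_1d_2d_pt_comp f (fun _ v => v));
    [|apply continuity_2d_pt_id2].
  now apply continuity_pt_filterlim.
Qed.

Lemma Ck2_continuity (n : nat) (I I' : R -> Prop) (f : R -> R -> R) :
  Ck2 n I I' f -> forall t s, I t -> I' s -> continuity_2d_pt f t s.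
Proof. destruct n; intros [H _]; exact H. Qed.

Lemma Ck2_D1 (n : nat) (I I' : R -> Prop) (f : R -> R -> R) :
  Ck2 (S n) I I' f -> Ck2 n I I' (D1 f).
Proof. now intros [_ [_ [H _]]]. Qed.

Lemma Ck2_D2 (n : nat) (I I' : R -> Prop) (f : R -> R -> R) :
  Ck2 (S n) I I' f -> Ck2 n I I' (D2 f).
Proof. now intros [_ [_ [_ H]]]. Qed.

Lemma Ck2_S (n : nat) (I I' : R -> Prop) (f : R -> R -> R) :
  Ck2 (S n) I I' f -> Ck2 n I I' f.
Proof.
  revert f. induction n as [|n IH]; intros f H.
  - split; [apply H | exact Logic.I].
  - destruct H as [Hc [Hd [H1 H2]]].
    split; [exact Hc|]. split; [exact Hd|].
    split; apply IH; assumption.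
Qed.

Lemma Ck2_derive1 (n : nat) (I I' : R -> Prop) (f : R -> R -> R) :
  Ck2 (S n) I I' f -> forall t s, I t -> I' s ->
  is_derive (fun x => f x s) t (D1 f t s).
Proof. intros [_ [H _]] t s Ht Hs. apply Derive_correct, (H t s Ht Hs). Qed.

Lemma Ck2_derive2 (n : nat) (I I' : R -> Prop) (f : R -> R -> R) :
  Ck2 (S n) I I' f -> forall t s, I t -> I' s ->
  is_derive (fun y => f t y) s (D2 f t s).
Proof. intros [_ [H _]] t s Ht Hs. apply Derive_correct, (H t s Ht Hs). Qed.

Section Calculus.

Context (I I' : R -> Prop) (hI : is_open_interval I) (hI' : is_open_interval I').

(** Being of class C^n on an open rectangle depends only on the values there,
    although [Ck2] speaks of total functions and of the total [Derive]. *)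
Lemma Ck2_ext (n : nat) (f g : R -> R -> R) :
  (forall t s, I t -> I' s -> f t s = g t s) -> Ck2 n I I' f -> Ck2 n I I' g.
Proof.
  revert f g. induction n as [|n IH]; intros f g Heq H.
  - split; [|exact Logic.I]. intros t s Ht Hs.
    apply continuity_2d_pt_ext_loc with f; [|now apply H].
    now apply (locally_2d_open I I').
  - assert (L1 : forall t s, I t -> I' s -> locally t (fun x => f x s = g x s)).
    { intros t s Ht Hs. generalize (open_interval_locally I t hI Ht).
      apply filter_imp. intros x Hx. now apply Heq. }
    assert (L2 : forall t s, I t -> I' s -> locally s (fun y => f t y = g t y)).
    { intros t s Ht Hs. generalize (open_interval_locally I' s hI' Hs).
      apply filter_imp. intros x Hx. now apply Heq. }
    destruct H as [Hc [Hd [H1 H2]]].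
    split; [|split; [|split]].
    + intros t s Ht Hs.
      apply continuity_2d_pt_ext_loc with f; [|now apply Hc].
      now apply (locally_2d_open I I').
    + intros t s Ht Hs. destruct (Hd t s Ht Hs) as [Hd1 Hd2]. split.
      * exact (ex_derive_ext_loc _ _ t (L1 t s Ht Hs) Hd1).
      * exact (ex_derive_ext_loc _ _ s (L2 t s Ht Hs) Hd2).
    + apply IH with (D1 f); [|exact H1].
      intros t s Ht Hs. now apply Derive_ext_loc, L1.
    + apply IH with (D2 f); [|exact H2].
      intros t s Ht Hs. now apply Derive_ext_loc, L2.
Qed.

(** Reduces each closure property below to a formula for the partial derivatives,
    which may be checked on the rectangle only. *)
Lemma Ck2_step (n : nat) (f f1 f2 : R -> R -> R) :
  (forall t s, I t -> I' s -> continuity_2d_pt f t s) ->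
  (forall t s, I t -> I' s -> is_derive (fun x => f x s) t (f1 t s)) ->
  (forall t s, I t -> I' s -> is_derive (fun y => f t y) s (f2 t s)) ->
  Ck2 n I I' f1 -> Ck2 n I I' f2 -> Ck2 (S n) I I' f.
Proof.
  intros Hc H1 H2 C1 C2. split; [exact Hc|]. split.
  - intros t s Ht Hs. split; eexists; [now apply H1|now apply H2].
  - split.
    + apply Ck2_ext with f1; [|exact C1].
      intros t s Ht Hs. symmetry. now apply is_derive_unique, H1.
    + apply Ck2_ext with f2; [|exact C2].
      intros t s Ht Hs. symmetry. now apply is_derive_unique, H2.
Qed.

Lemma Ck2_const (n : nat) (c : R) : Ck2 n I I' (fun _ _ => c).
Proof.
  revert c. induction n as [|n IH]; intros c.
  - split; [|exact Logic.I]. intros; apply continuity_2d_pt_const.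
  - apply Ck2_step with (fun _ _ => 0) (fun _ _ => 0); try apply IH.
    + intros; apply continuity_2d_pt_const.
    + intros; apply @is_derive_const.
    + intros; apply @is_derive_const.
Qed.

Lemma Ck2_plus (n : nat) (f g : R -> R -> R) :
  Ck2 n I I' f -> Ck2 n I I' g -> Ck2 n I I' (fun t s => f t s + g t s).
Proof.
  revert f g. induction n as [|n IH]; intros f g Hf Hg.
  - split; [|exact Logic.I]. intros t s Ht Hs.
    apply continuity_2d_pt_plus; [now apply Hf|now apply Hg].
  - apply Ck2_step with (fun t s => D1 f t s + D1 g t s)
      (fun t s => D2 f t s + D2 g t s).
    + intros t s Ht Hs. apply continuity_2d_pt_plus; [now apply Hf|now apply Hg].
    + intros t s Ht Hs. apply @is_derive_plus; eapply Ck2_derive1; eauto.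
    + intros t s Ht Hs. apply @is_derive_plus; eapply Ck2_derive2; eauto.
    + apply IH; now apply Ck2_D1.
    + apply IH; now apply Ck2_D2.
Qed.

Lemma Ck2_mult (n : nat) (f g : R -> R -> R) :
  Ck2 n I I' f -> Ck2 n I I' g -> Ck2 n I I' (fun t s => f t s * g t s).
Proof.
  revert f g. induction n as [|n IH]; intros f g Hf Hg.
  - split; [|exact Logic.I]. intros t s Ht Hs.
    apply continuity_2d_pt_mult; [now apply Hf|now apply Hg].
  - apply Ck2_step with (fun t s => D1 f t s * g t s + f t s * D1 g t s)
      (fun t s => D2 f t s * g t s + f t s * D2 g t s).
    + intros t s Ht Hs. apply continuity_2d_pt_mult; [now apply Hf|now apply Hg].
    + intros t s Ht Hs. apply (is_derive_mult (fun x => f x s) (fun x => g x s));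
        [eapply Ck2_derive1; eauto | eapply Ck2_derive1; eauto | apply Rmult_comm].
    + intros t s Ht Hs. apply (is_derive_mult (fun x => f t x) (fun x => g t x));
        [eapply Ck2_derive2; eauto | eapply Ck2_derive2; eauto | apply Rmult_comm].
    + apply Ck2_plus; apply IH; auto using Ck2_S, Ck2_D1.
    + apply Ck2_plus; apply IH; auto using Ck2_S, Ck2_D2.
Qed.

Lemma Ck2_inv (n : nat) (f : R -> R -> R) :
  (forall t s, I t -> I' s -> f t s <> 0) ->
  Ck2 n I I' f -> Ck2 n I I' (fun t s => / f t s).
Proof.
  intros H0. induction n as [|n IH]; intros Hf.
  - split; [|exact Logic.I]. intros t s Ht Hs.
    apply continuity_2d_pt_inv; [now apply Hf|now apply H0].
  - assert (Hi := IH (Ck2_S _ _ _ _ Hf)).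
    apply Ck2_step with (fun t s => (-1) * (D1 f t s * (/ f t s * / f t s)))
      (fun t s => (-1) * (D2 f t s * (/ f t s * / f t s))).
    + intros t s Ht Hs. apply continuity_2d_pt_inv; [now apply Hf|now apply H0].
    + intros t s Ht Hs.
      replace (-1 * _) with (- D1 f t s / f t s ^ 2) by (field; now apply H0).
      apply (is_derive_inv (fun x => f x s)); [|now apply H0].
      eapply Ck2_derive1; eauto.
    + intros t s Ht Hs.
      replace (-1 * _) with (- D2 f t s / f t s ^ 2) by (field; now apply H0).
      apply (is_derive_inv (fun x => f t x)); [|now apply H0].
      eapply Ck2_derive2; eauto.
    + repeat apply Ck2_mult; auto using Ck2_const, Ck2_D1.
    + repeat apply Ck2_mult; auto using Ck2_const, Ck2_D2.
Qed.

Definition smooth_on (J : R -> Prop) (f : R -> R) : Prop :=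
  forall (n : nat) (x : R), J x -> ex_derive_n f n x.

Lemma smooth_on_derive (J : R -> Prop) (f : R -> R) (x : R) :
  smooth_on J f -> J x -> is_derive f x (Derive f x).
Proof. intros H Hx. apply Derive_correct, (H 1%nat x Hx). Qed.

Lemma smooth_on_Derive (J : R -> Prop) (f : R -> R) :
  smooth_on J f -> smooth_on J (Derive f).
Proof.
  intros H [|n] x Hx; [exact Logic.I|].
  generalize (H (S (S n)) x Hx). simpl.
  apply ex_derive_ext. intros y.
  change (Derive (Derive_n f n) y) with (Derive_n f (1 + n) y).
  rewrite PeanoNat.Nat.add_comm.
  now rewrite <- (Derive_n_comp f n 1).
Qed.

Lemma Ck2_fst (n : nat) (f : R -> R) :
  smooth_on I f -> Ck2 n I I' (fun t _ => f t).
Proof.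
  revert f. induction n as [|n IH]; intros f Hf.
  - split; [|exact Logic.I]. intros t s Ht Hs.
    apply continuity_2d_pt_fst_of, (ex_derive_continuous f), (Hf 1%nat t Ht).
  - apply Ck2_step with (fun t _ => Derive f t) (fun _ _ => 0).
    + intros t s Ht Hs.
      apply continuity_2d_pt_fst_of, (ex_derive_continuous f), (Hf 1%nat t Ht).
    + intros t s Ht Hs. now apply (smooth_on_derive I).
    + intros t s Ht Hs. apply @is_derive_const.
    + now apply IH, smooth_on_Derive.
    + apply Ck2_const.
Qed.

Lemma Ck2_snd (n : nat) (f : R -> R) :
  smooth_on I' f -> Ck2 n I I' (fun _ s => f s).
Proof.
  revert f. induction n as [|n IH]; intros f Hf.
  - split; [|exact Logic.I]. intros t s Ht Hs.
    apply continuity_2d_pt_snd_of, (ex_derive_continuous f), (Hf 1%nat s Hs).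
  - apply Ck2_step with (fun _ _ => 0) (fun _ s => Derive f s).
    + intros t s Ht Hs.
      apply continuity_2d_pt_snd_of, (ex_derive_continuous f), (Hf 1%nat s Hs).
    + intros t s Ht Hs. apply @is_derive_const.
    + intros t s Ht Hs. now apply (smooth_on_derive I').
    + apply Ck2_const.
    + now apply IH, smooth_on_Derive.
Qed.

End Calculus.

(** * Double integrals depending on a parameter *)

Lemma continuity_2d_pt_snd (f : R -> R -> R) (t s : R) :
  continuity_2d_pt f t s -> continuous (f t) s.
Proof.
  intros H. apply continuity_pt_filterlim. intros e He.
  destruct (H (mkposreal e He)) as [d Hd].
  exists d. split; [apply cond_pos|]. intros y [_ Hy].
  apply (Hd t y); [|exact Hy].
  rewrite Rminus_diag, Rabs_R0. apply cond_pos.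
Qed.

(** A step of length less than the modulus of uniform continuity for 1 changes f by
    at most 1, and boundedly many such steps lead from the left edge, where f is
    bounded as a function of one variable, to any point. *)
Lemma bounded_on_rectangle (f : R -> R -> R) (t0 t1 s0 s1 : R) :
  t0 <= t1 -> s0 <= s1 ->
  (forall t s, t0 <= t <= t1 -> s0 <= s <= s1 -> continuity_2d_pt f t s) ->
  exists M, 0 < M /\ forall t s, t0 <= t <= t1 -> s0 <= s <= s1 -> Rabs (f t s) <= M.
Proof.
  intros Ht Hs Hf.
  destruct (uniform_continuity_2d f t0 t1 s0 s1 Hf (mkposreal 1 Rlt_0_1)) as [d Hd].
  destruct (continuity_ab_maj (fun s => Rabs (f t0 s)) s0 s1 Hs) as [sM [HM _]].
  { intros s Hs'. apply (continuity_pt_comp (f t0) Rabs); [|apply Rcontinuity_abs].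
    apply continuity_pt_filterlim, continuity_2d_pt_snd, Hf; lra. }
  assert (Hpos := cond_pos d).
  assert (Hstep : forall n t s, t0 <= t <= t1 -> s0 <= s <= s1 ->
            t <= t0 + INR n * (d / 2) -> Rabs (f t s) <= Rabs (f t0 sM) + INR n).
  { induction n as [|n IH]; intros t s Ht' Hs' Hn.
    - simpl in Hn |- *. replace t with t0 by lra. generalize (HM s Hs'). lra.
    - rewrite S_INR in Hn |- *.
      assert (Hx : exists x, t0 <= x <= t1 /\ x <= t0 + INR n * (d / 2) /\
                             Rabs (t - x) < d).
      { exists (Rmax t0 (t - d / 2)).
        assert (0 <= INR n * (d / 2)) by (apply Rmult_le_pos; [apply pos_INR|lra]).
        unfold Rmax. destruct (Rle_dec t0 (t - d / 2)).
        - repeat split; try lra. rewrite Rabs_pos_eq; lra.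
        - repeat split; try lra. rewrite Rabs_pos_eq; lra. }
      destruct Hx as [x [Hx [Hxn Htx]]].
      assert (H1 := IH x s Hx Hs' Hxn).
      assert (H2 : Rabs (f t s - f x s) < 1).
      { apply (Hd x s t s); auto. rewrite Rminus_diag, Rabs_R0. exact Hpos. }
      generalize (Rabs_triang_inv (f t s) (f x s)). lra. }
  destruct (INR_archimed (d / 2) (t1 - t0)) as [n Hn]; [lra|].
  exists (Rabs (f t0 sM) + INR n + 1). split.
  - generalize (Rabs_pos (f t0 sM)) (pos_INR n). lra.
  - intros t s Ht' Hs'.
    assert (H := Hstep n t s Ht' Hs'). lra.
Qed.

Definition double_integral (f : R -> R -> R) (t0 t1 s0 s1 : R) : R :=
  RInt (fun t => RInt (f t) s0 s1) t0 t1.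

Section Rectangle.

Context (I I' : R -> Prop) (hI : is_open_interval I) (hI' : is_open_interval I').
Context (t0 t1 s0 s1 : R) (Ht0 : I t0) (Ht1 : I t1) (Ht : t0 <= t1)
  (Hs0 : I' s0) (Hs1 : I' s1) (Hs : s0 <= s1).

Notation cont f := (forall t s, I t -> I' s -> continuity_2d_pt f t s).

Lemma inner_ex_RInt (f : R -> R -> R) (t : R) :
  cont f -> I t -> ex_RInt (f t) s0 s1.
Proof using Hs0 Hs1 Hs hI'.
  intros Hf It. apply (ex_RInt_continuous (V := R_CompleteNormedModule)).
  rewrite Rmin_left, Rmax_right by exact Hs. intros s Hs'.
  apply continuity_2d_pt_snd, Hf; [exact It|].
  now apply (open_interval_between I' s0 s1).
Qed.

Lemma continuous_inner_RInt (f : R -> R -> R) (t : R) :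
  cont f -> I t -> continuous (fun x => RInt (f x) s0 s1) t.
Proof using hI hI' Hs0 Hs1 Hs.
  intros Hf It.
  destruct (open_interval_locally I t hI It) as [r Hr].
  assert (Hrpos := cond_pos r).
  assert (HrI : forall x, t - r / 2 <= x <= t + r / 2 -> I x).
  { intros x Hx. apply Hr. change (Rabs (x - t) < r).
    apply Rabs_lt_between'. lra. }
  apply continuity_pt_filterlim. intros e He.
  assert (He' : 0 < e / (s1 - s0 + 1)) by (apply Rdiv_lt_0_compat; lra).
  destruct (uniform_continuity_2d f (t - r / 2) (t + r / 2) s0 s1) with
    (eps := mkposreal _ He') as [d Hd].
  { intros x s Hx Hs'. apply Hf; [now apply HrI|].
    now apply (open_interval_between I' s0 s1). }
  exists (Rmin d (r / 2)). split.
  { apply Rmin_pos; [apply cond_pos|lra]. }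
  intros x [_ Hx]. simpl in Hx |- *. unfold Rdist in *.
  assert (Hx1 : Rabs (x - t) < d) by (apply Rlt_le_trans with (1 := Hx), Rmin_l).
  assert (Hx2 : Rabs (x - t) < r / 2) by (apply Rlt_le_trans with (1 := Hx), Rmin_r).
  apply Rabs_lt_between' in Hx2.
  assert (Ix : I x) by (apply HrI; lra).
  assert (E := RInt_minus (V := R_CompleteNormedModule) (f x) (f t) s0 s1
                 (inner_ex_RInt f x Hf Ix) (inner_ex_RInt f t Hf It)).
  change (RInt (fun s => f x s - f t s) s0 s1
          = RInt (f x) s0 s1 - RInt (f t) s0 s1) in E.
  rewrite <- E.
  apply Rle_lt_trans with ((s1 - s0) * (e / (s1 - s0 + 1))).
  - apply abs_RInt_le_const; [exact Hs| |].
    + apply (ex_RInt_minus (V := R_CompleteNormedModule)); now apply inner_ex_RInt.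
    + intros s Hs'. apply Rlt_le, Hd; try lra.
      rewrite Rminus_diag, Rabs_R0. apply cond_pos.
  - apply Rmult_lt_reg_r with (s1 - s0 + 1); [lra|].
    replace ((s1 - s0) * (e / (s1 - s0 + 1)) * (s1 - s0 + 1)) with ((s1 - s0) * e)
      by (field; lra).
    nra.
Qed.

Lemma outer_ex_RInt (f : R -> R -> R) :
  cont f -> ex_RInt (fun t => RInt (f t) s0 s1) t0 t1.
Proof using hI hI' Ht0 Ht1 Ht Hs0 Hs1 Hs.
  intros Hf. apply (ex_RInt_continuous (V := R_CompleteNormedModule)).
  rewrite Rmin_left, Rmax_right by exact Ht. intros t Ht'.
  apply continuous_inner_RInt; [exact Hf|].
  now apply (open_interval_between I t0 t1).
Qed.

Lemma double_integral_plus (f g : R -> R -> R) :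
  cont f -> cont g ->
  double_integral (fun t s => f t s + g t s) t0 t1 s0 s1
  = double_integral f t0 t1 s0 s1 + double_integral g t0 t1 s0 s1.
Proof using hI hI' Ht0 Ht1 Ht Hs0 Hs1 Hs.
  intros Hf Hg. unfold double_integral.
  rewrite <- (RInt_plus (V := R_CompleteNormedModule)) by now apply outer_ex_RInt.
  apply RInt_ext. rewrite Rmin_left, Rmax_right by exact Ht. intros t Ht'.
  assert (It : I t) by (apply (open_interval_between I t0 t1); auto; lra).
  apply (RInt_plus (V := R_CompleteNormedModule)); now apply inner_ex_RInt.
Qed.

Lemma double_integral_scal (c : R) (f : R -> R -> R) :
  cont f ->
  double_integral (fun t s => c * f t s) t0 t1 s0 s1
  = c * double_integral f t0 t1 s0 s1.
Proof using hI hI' Ht0 Ht1 Ht Hs0 Hs1 Hs.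
  intros Hf. unfold double_integral.
  rewrite <- (RInt_scal (V := R_CompleteNormedModule)) by now apply outer_ex_RInt.
  apply RInt_ext. rewrite Rmin_left, Rmax_right by exact Ht. intros t Ht'.
  assert (It : I t) by (apply (open_interval_between I t0 t1); auto; lra).
  apply (RInt_scal (V := R_CompleteNormedModule)); now apply inner_ex_RInt.
Qed.

Lemma double_integral_ext (f g : R -> R -> R) :
  (forall t s, I t -> I' s -> f t s = g t s) ->
  double_integral f t0 t1 s0 s1 = double_integral g t0 t1 s0 s1.
Proof using hI hI' Ht0 Ht1 Ht Hs0 Hs1 Hs.
  intros E. unfold double_integral.
  apply RInt_ext. rewrite Rmin_left, Rmax_right by exact Ht. intros t Ht'.
  apply RInt_ext. rewrite Rmin_left, Rmax_right by exact Hs. intros s Hs'.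
  apply E; [apply (open_interval_between I t0 t1)|apply (open_interval_between I' s0 s1)];
    auto; lra.
Qed.

Lemma double_integral_bound (f : R -> R -> R) (K : R) :
  cont f ->
  (forall t s, t0 <= t <= t1 -> s0 <= s <= s1 -> Rabs (f t s) <= K) ->
  Rabs (double_integral f t0 t1 s0 s1) <= (t1 - t0) * ((s1 - s0) * K).
Proof using hI hI' Ht0 Ht1 Ht Hs0 Hs1 Hs.
  intros Hf HK. apply abs_RInt_le_const; [exact Ht|now apply outer_ex_RInt|].
  intros t Ht'. apply abs_RInt_le_const; [exact Hs| |].
  - apply inner_ex_RInt; [exact Hf|]. now apply (open_interval_between I t0 t1).
  - intros s Hs'. now apply HK.
Qed.

(** The remainder of the first order expansion in the parameter is of second order
    uniformly on the rectangle, and integration keeps it so. *)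
Lemma is_derive_double_integral (h : R -> R -> R -> R) (m : R -> R -> R) (d K : R) :
  0 < d -> 0 <= K ->
  (forall e, cont (h e)) -> cont m ->
  (forall e t s, Rabs e <= d -> t0 <= t <= t1 -> s0 <= s <= s1 ->
     Rabs (h e t s - h 0 t s - e * m t s) <= K * e ^ 2) ->
  is_derive (fun e => double_integral (h e) t0 t1 s0 s1) 0
    (double_integral m t0 t1 s0 s1).
Proof using hI hI' Ht0 Ht1 Ht Hs0 Hs1 Hs.
  intros Hd HK Hh Hm Hest.
  assert (Hest2 : forall e, Rabs e <= d ->
     Rabs (double_integral (h e) t0 t1 s0 s1 - double_integral (h 0) t0 t1 s0 s1
           - e * double_integral m t0 t1 s0 s1)
     <= (t1 - t0) * ((s1 - s0) * K) * e ^ 2).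
  { intros e He.
    assert (Hc : cont (fun t s => (-1) * h 0 t s + (- e) * m t s)).
    { intros t s It Is. apply continuity_2d_pt_plus; apply continuity_2d_pt_mult;
      try apply continuity_2d_pt_const; [now apply Hh|now apply Hm]. }
    assert (Hc' : forall c f, cont f -> cont (fun t s => c * f t s)).
    { intros c f Hf t s It Is. apply continuity_2d_pt_mult;
      [apply continuity_2d_pt_const|now apply Hf]. }
    replace (_ - _ - _) with
      (double_integral (fun t s => h e t s + ((-1) * h 0 t s + (- e) * m t s)) t0 t1 s0 s1).
    2:{ rewrite double_integral_plus by auto.
        rewrite double_integral_plus by auto.
        rewrite !double_integral_scal by auto. ring. }
    replace (_ * e ^ 2) with ((t1 - t0) * ((s1 - s0) * (K * e ^ 2))) by ring.
    apply double_integral_bound.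
    - intros t s It Is. apply continuity_2d_pt_plus; [now apply Hh|now apply Hc].
    - intros t s Ht' Hs'.
      replace (_ + _) with (h e t s - h 0 t s - e * m t s) by ring. now apply Hest. }
  set (K' := (t1 - t0) * ((s1 - s0) * K)) in *.
  assert (HK' : 0 <= K') by (unfold K'; repeat apply Rmult_le_pos; lra).
  apply is_derive_Reals. intros e He.
  assert (Hpos : 0 < Rmin d (e / (K' + 1))).
  { apply Rmin_pos; [exact Hd|]. apply Rdiv_lt_0_compat; lra. }
  exists (mkposreal _ Hpos). simpl. intros x Hx0 Hx.
  assert (Hx1 : Rabs x < d) by (apply Rlt_le_trans with (1 := Hx), Rmin_l).
  assert (Hx2 : Rabs x < e / (K' + 1)) by (apply Rlt_le_trans with (1 := Hx), Rmin_r).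
  rewrite Rplus_0_l.
  set (A := double_integral (h x) t0 t1 s0 s1).
  set (B := double_integral (h 0) t0 t1 s0 s1).
  set (D := double_integral m t0 t1 s0 s1).
  assert (Habs : 0 < Rabs x) by now apply Rabs_pos_lt.
  replace ((A - B) / x - D) with ((A - B - x * D) / x) by (field; exact Hx0).
  rewrite Rabs_div by exact Hx0.
  apply Rmult_lt_reg_r with (Rabs x); [exact Habs|].
  replace (Rabs (A - B - x * D) / Rabs x * Rabs x) with (Rabs (A - B - x * D))
    by (field; lra).
  apply Rle_lt_trans with (1 := Hest2 x (Rlt_le _ _ Hx1)).
  rewrite <- pow2_abs.
  assert (Hm1 : Rabs x * (K' + 1) < e).
  { apply Rmult_lt_compat_r with (r := K' + 1) in Hx2; [|lra].
    replace (e / (K' + 1) * (K' + 1)) with e in Hx2 by (field; lra). exact Hx2. }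
  nra.
Qed.

End Rectangle.

(** The square of w = l + e m is l^2 + 2 e l m + e^2 m^2, so P and w^2 differ by
    O(e^2); and w stays away from 0, so sqrt P and w differ by O(e^2) too. Where P
    is negative this still holds, as sqrt P is 0 and w^2 is at most w^2 - P. *)
Lemma sqrt_taylor (c M : R) :
  0 < c -> 0 < M ->
  exists d K : R, 0 < d <= 1 /\ 0 <= K /\
  forall e l m P : R, Rabs e <= d -> c <= l -> Rabs m <= M ->
    Rabs (P - l ^ 2 - 2 * e * l * m) <= M * e ^ 2 ->
    Rabs (sqrt P - l - e * m) <= K * e ^ 2.
Proof.
  intros Hc HM.
  exists (Rmin 1 (c / (2 * M))), ((M + M ^ 2) * (2 / c)).
  assert (Hc2 : 0 < 2 / c) by (apply Rdiv_lt_0_compat; lra).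
  split; [split; [apply Rmin_pos; [lra|apply Rdiv_lt_0_compat; lra]|apply Rmin_l]|].
  split; [apply Rmult_le_pos; nra|].
  intros e l m P He Hl Hm HP.
  assert (He2 : Rabs e <= c / (2 * M)) by (apply Rle_trans with (1 := He), Rmin_r).
  assert (Hem : Rabs (e * m) <= c / 2).
  { rewrite Rabs_mult. apply Rle_trans with (c / (2 * M) * M).
    - apply Rmult_le_compat; try apply Rabs_pos; assumption.
    - right. field. lra. }
  apply Rabs_le_between in Hem.
  set (w := l + e * m).
  assert (Hw : c / 2 <= w) by (unfold w; lra).
  assert (Hm2 : m ^ 2 <= M ^ 2).
  { rewrite <- (pow2_abs m). apply pow_incr. split; [apply Rabs_pos|exact Hm]. }
  assert (He0 : 0 <= e ^ 2) by apply pow2_ge_0.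
  assert (Hdiff : Rabs (P - w ^ 2) <= (M + M ^ 2) * e ^ 2).
  { replace (P - w ^ 2) with ((P - l ^ 2 - 2 * e * l * m) + - (e ^ 2 * m ^ 2))
      by (unfold w; ring).
    apply Rle_trans with (1 := Rabs_triang _ _).
    rewrite Rabs_Ropp, (Rabs_pos_eq (e ^ 2 * m ^ 2)); nra. }
  replace (sqrt P - l - e * m) with (sqrt P - w) by (unfold w; ring).
  assert (Hmain : Rabs (sqrt P - w) * w <= (M + M ^ 2) * e ^ 2).
  { destruct (Rle_dec 0 P) as [HP0|HP0].
    - assert (Hs := sqrt_pos P). assert (Hss := pow2_sqrt P HP0).
      replace (P - w ^ 2) with ((sqrt P - w) * (sqrt P + w)) in Hdiff
        by (rewrite <- Hss at 3; ring).
      rewrite Rabs_mult, (Rabs_pos_eq (sqrt P + w)) in Hdiff by lra.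
      generalize (Rabs_pos (sqrt P - w)). nra.
    - rewrite sqrt_neg_0 by lra. rewrite Rminus_0_l, Rabs_Ropp, Rabs_pos_eq by lra.
      rewrite Rabs_left in Hdiff by nra. nra. }
  apply Rmult_le_reg_r with (c / 2); [lra|].
  apply Rle_trans with ((M + M ^ 2) * e ^ 2).
  - apply Rle_trans with (2 := Hmain). apply Rmult_le_compat_l; [apply Rabs_pos|exact Hw].
  - right. field. lra.
Qed.

(** * The first variation of area of a conformal Lagrangian surface *)

Definition surface_Ck (n : nat) (I I' : R -> Prop) (X : R -> R -> C2) : Prop :=
  Ck2 n I I' (fun t s => Re (fst (X t s))) /\ Ck2 n I I' (fun t s => Im (fst (X t s))) /\
  Ck2 n I I' (fun t s => Re (snd (X t s))) /\ Ck2 n I I' (fun t s => Im (snd (X t s))).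

Ltac C2ring :=
  intros; repeat match goal with v : C2 |- _ => destruct v as [[? ?] [? ?]] end;
  unfold omega, dot, J, C2add, C2scal; simpl; ring.

Lemma dot_add_scal (a b c d : C2) (e : R) :
  dot (C2add a (C2scal e b)) (C2add c (C2scal e d))
  = dot a c + e * (dot a d + dot b c) + e ^ 2 * dot b d.
Proof. C2ring. Qed.

Lemma dot_comm (v w : C2) : dot v w = dot w v.
Proof. C2ring. Qed.

Lemma dot_J_span (a b : C2) (p q u v : R) :
  dot (J (C2add (C2scal p a) (C2scal q b))) (J (C2add (C2scal u a) (C2scal v b)))
  = p * u * dot a a + (p * v + q * u) * dot a b + q * v * dot b b.
Proof. C2ring. Qed.

Lemma dot_J_span_l (a b : C2) (u v : R) :
  dot a (J (C2add (C2scal u a) (C2scal v b))) = - v * omega a b.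
Proof. C2ring. Qed.

Lemma dot_J_span_r (a b : C2) (u v : R) :
  dot b (J (C2add (C2scal u a) (C2scal v b))) = u * omega a b.
Proof. C2ring. Qed.

Lemma dot_add_l (a b c : C2) : dot (C2add a b) c = dot a c + dot b c.
Proof. C2ring. Qed.

Section Surfaces.

Context (I I' : R -> Prop) (hI : is_open_interval I) (hI' : is_open_interval I').

Lemma surface_Ck_S (n : nat) (X : R -> R -> C2) :
  surface_Ck (S n) I I' X -> surface_Ck n I I' X.
Proof. intros [H1 [H2 [H3 H4]]]. repeat split; now apply Ck2_S. Qed.

Lemma surface_Ck_pd1 (n : nat) (X : R -> R -> C2) :
  surface_Ck (S n) I I' X -> surface_Ck n I I' (pd1 X).
Proof.
  intros [H1 [H2 [H3 H4]]].
  exact (conj (Ck2_D1 _ _ _ _ H1) (conj (Ck2_D1 _ _ _ _ H2)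
        (conj (Ck2_D1 _ _ _ _ H3) (Ck2_D1 _ _ _ _ H4)))).
Qed.

Lemma surface_Ck_pd2 (n : nat) (X : R -> R -> C2) :
  surface_Ck (S n) I I' X -> surface_Ck n I I' (pd2 X).
Proof.
  intros [H1 [H2 [H3 H4]]].
  exact (conj (Ck2_D2 _ _ _ _ H1) (conj (Ck2_D2 _ _ _ _ H2)
        (conj (Ck2_D2 _ _ _ _ H3) (Ck2_D2 _ _ _ _ H4)))).
Qed.

Lemma surface_Ck_add (n : nat) (X Y : R -> R -> C2) :
  surface_Ck n I I' X -> surface_Ck n I I' Y ->
  surface_Ck n I I' (fun t s => C2add (X t s) (Y t s)).
Proof using hI hI'.
  intros [H1 [H2 [H3 H4]]] [K1 [K2 [K3 K4]]].
  repeat split; simpl; now apply Ck2_plus.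
Qed.

Lemma surface_Ck_scal (n : nat) (u : R -> R -> R) (X : R -> R -> C2) :
  Ck2 n I I' u -> surface_Ck n I I' X ->
  surface_Ck n I I' (fun t s => C2scal (u t s) (X t s)).
Proof using hI hI'.
  intros Hu [H1 [H2 [H3 H4]]].
  assert (aux : forall f g, Ck2 n I I' f ->
            (forall t s, I t -> I' s -> u t s * f t s = g t s) -> Ck2 n I I' g).
  { intros f g Hf E. apply (Ck2_ext I I' hI hI' n _ g E). now apply Ck2_mult. }
  repeat split;
    [apply (aux _ _ H1)|apply (aux _ _ H2)|apply (aux _ _ H3)|apply (aux _ _ H4)];
    intros; unfold Re, Im; simpl; ring.
Qed.

Lemma surface_Ck_J (n : nat) (X : R -> R -> C2) :
  surface_Ck n I I' X -> surface_Ck n I I' (fun t s => J (X t s)).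
Proof using hI hI'.
  intros [H1 [H2 [H3 H4]]].
  assert (aux : forall f g c, Ck2 n I I' f ->
            (forall t s, I t -> I' s -> c * f t s = g t s) -> Ck2 n I I' g).
  { intros f g c Hf E. apply (Ck2_ext I I' hI hI' n _ g E).
    apply (Ck2_mult I I' hI hI' n (fun _ _ => c)); auto using Ck2_const. }
  repeat split;
    [apply (aux _ _ (-1) H2)|apply (aux _ _ 1 H1)
    |apply (aux _ _ (-1) H4)|apply (aux _ _ 1 H3)]; intros; unfold Re, Im; simpl; ring.
Qed.

Lemma Ck2_dot (n : nat) (X Y : R -> R -> C2) :
  surface_Ck n I I' X -> surface_Ck n I I' Y ->
  Ck2 n I I' (fun t s => dot (X t s) (Y t s)).
Proof using hI hI'.
  intros [H1 [H2 [H3 H4]]] [K1 [K2 [K3 K4]]].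
  apply (Ck2_ext I I' hI hI') with (fun t s =>
    (Re (fst (X t s)) * Re (fst (Y t s)) + Im (fst (X t s)) * Im (fst (Y t s)))
    + (Re (snd (X t s)) * Re (snd (Y t s)) + Im (snd (X t s)) * Im (snd (Y t s)))).
  - intros t s _ _. unfold dot. simpl. unfold Re, Im. ring.
  - repeat apply (Ck2_plus I I' hI hI'); now apply (Ck2_mult I I' hI hI').
Qed.

Lemma pd1_dot (X Y : R -> R -> C2) (t s : R) :
  surface_Ck 1 I I' X -> surface_Ck 1 I I' Y -> I t -> I' s ->
  is_derive (fun x => dot (X x s) (Y x s)) t
    (dot (pd1 X t s) (Y t s) + dot (X t s) (pd1 Y t s)).
Proof using.
  intros [H1 [H2 [H3 H4]]] [K1 [K2 [K3 K4]]] It Is.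
  assert (aux : forall f g : R -> R -> R, Ck2 1 I I' f -> Ck2 1 I I' g ->
    is_derive (fun x => f x s * g x s) t (D1 f t s * g t s + f t s * D1 g t s)).
  { intros f g Hf Hg.
    apply (is_derive_mult (fun x => f x s) (fun x => g x s));
      [eapply Ck2_derive1; eauto | eapply Ck2_derive1; eauto | apply Rmult_comm]. }
  assert (A1 := aux _ _ H1 K1). assert (A2 := aux _ _ H2 K2).
  assert (A3 := aux _ _ H3 K3). assert (A4 := aux _ _ H4 K4).
  assert (A := is_derive_plus _ _ _ _ _ (is_derive_plus _ _ _ _ _ A1 A2)
                 (is_derive_plus _ _ _ _ _ A3 A4)).
  eapply is_derive_ext; [|eapply (eq_ind _ (is_derive _ _) A)].
  - intros x. unfold dot, plus. simpl. unfold Re, Im. ring.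
  - unfold dot, plus, pd1, C2Derive, CDerive, D1. simpl. unfold Re, Im. ring.
Qed.

Lemma pd2_dot (X Y : R -> R -> C2) (t s : R) :
  surface_Ck 1 I I' X -> surface_Ck 1 I I' Y -> I t -> I' s ->
  is_derive (fun y => dot (X t y) (Y t y)) s
    (dot (pd2 X t s) (Y t s) + dot (X t s) (pd2 Y t s)).
Proof using.
  intros [H1 [H2 [H3 H4]]] [K1 [K2 [K3 K4]]] It Is.
  assert (aux : forall f g : R -> R -> R, Ck2 1 I I' f -> Ck2 1 I I' g ->
    is_derive (fun y => f t y * g t y) s (D2 f t s * g t s + f t s * D2 g t s)).
  { intros f g Hf Hg.
    apply (is_derive_mult (fun y => f t y) (fun y => g t y));
      [eapply Ck2_derive2; eauto | eapply Ck2_derive2; eauto | apply Rmult_comm]. }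
  assert (A1 := aux _ _ H1 K1). assert (A2 := aux _ _ H2 K2).
  assert (A3 := aux _ _ H3 K3). assert (A4 := aux _ _ H4 K4).
  assert (A := is_derive_plus _ _ _ _ _ (is_derive_plus _ _ _ _ _ A1 A2)
                 (is_derive_plus _ _ _ _ _ A3 A4)).
  eapply is_derive_ext; [|eapply (eq_ind _ (is_derive _ _) A)].
  - intros x. unfold dot, plus. simpl. unfold Re, Im. ring.
  - unfold dot, plus, pd2, C2Derive, CDerive, D2. simpl. unfold Re, Im. ring.
Qed.

(** Moves a derivative from a normal field Y to X, so that only second derivatives
    of the surface, and none of the variation field, enter the first variation. *)
Lemma pd1_dot_orthogonal (X Y : R -> R -> C2) (t s : R) :
  surface_Ck 1 I I' X -> surface_Ck 1 I I' Y -> I t -> I' s ->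
  (forall t s, I t -> I' s -> dot (X t s) (Y t s) = 0) ->
  dot (X t s) (pd1 Y t s) = - dot (pd1 X t s) (Y t s).
Proof using hI.
  intros HX HY It Is H0.
  assert (H : Derive (fun x => dot (X x s) (Y x s)) t
              = dot (pd1 X t s) (Y t s) + dot (X t s) (pd1 Y t s))
    by now apply is_derive_unique, pd1_dot.
  assert (E : Derive (fun x => dot (X x s) (Y x s)) t = Derive (fun _ => 0) t).
  { apply Derive_ext_loc. generalize (open_interval_locally I t hI It).
    apply filter_imp. intros x Ix. now apply H0. }
  rewrite Derive_const in E. lra.
Qed.

Lemma pd2_dot_orthogonal (X Y : R -> R -> C2) (t s : R) :
  surface_Ck 1 I I' X -> surface_Ck 1 I I' Y -> I t -> I' s ->
  (forall t s, I t -> I' s -> dot (X t s) (Y t s) = 0) ->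
  dot (X t s) (pd2 Y t s) = - dot (pd2 X t s) (Y t s).
Proof using hI'.
  intros HX HY It Is H0.
  assert (H : Derive (fun y => dot (X t y) (Y t y)) s
              = dot (pd2 X t s) (Y t s) + dot (X t s) (pd2 Y t s))
    by now apply is_derive_unique, pd2_dot.
  assert (E : Derive (fun y => dot (X t y) (Y t y)) s = Derive (fun _ => 0) s).
  { apply Derive_ext_loc. generalize (open_interval_locally I' s hI' Is).
    apply filter_imp. intros x Ix. now apply H0. }
  rewrite Derive_const in E. lra.
Qed.

Lemma pd1_variation (X V : R -> R -> C2) (e t s : R) :
  surface_Ck 1 I I' X -> surface_Ck 1 I I' V -> I t -> I' s ->
  pd1 (variation X V e) t s = C2add (pd1 X t s) (C2scal e (pd1 V t s)).
Proof using.
  intros [H1 [H2 [H3 H4]]] [K1 [K2 [K3 K4]]] It Is.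
  assert (aux : forall f g h : R -> R -> R, Ck2 1 I I' f -> Ck2 1 I I' g ->
    (forall x, f x s + e * g x s = h x s) ->
    Derive (fun x => h x s) t = D1 f t s + e * D1 g t s).
  { intros f g h Hf Hg E. apply is_derive_unique.
    eapply is_derive_ext; [exact E|].
    apply @is_derive_plus; [eapply Ck2_derive1; eauto|].
    apply (is_derive_scal (fun x => g x s)). eapply Ck2_derive1; eauto. }
  unfold pd1 at 1. unfold C2Derive, CDerive.
  rewrite (aux _ _ (fun t s => Re (fst (variation X V e t s))) H1 K1),
    (aux _ _ (fun t s => Im (fst (variation X V e t s))) H2 K2),
    (aux _ _ (fun t s => Re (snd (variation X V e t s))) H3 K3),
    (aux _ _ (fun t s => Im (snd (variation X V e t s))) H4 K4);
  try (intros; unfold variation, C2add, C2scal, Re, Im; simpl; ring).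
  unfold pd1, C2Derive, CDerive, C2add, C2scal, Cmult, Cplus, RtoC, D1. simpl.
  f_equal; f_equal; ring.
Qed.

Lemma pd2_variation (X V : R -> R -> C2) (e t s : R) :
  surface_Ck 1 I I' X -> surface_Ck 1 I I' V -> I t -> I' s ->
  pd2 (variation X V e) t s = C2add (pd2 X t s) (C2scal e (pd2 V t s)).
Proof using.
  intros [H1 [H2 [H3 H4]]] [K1 [K2 [K3 K4]]] It Is.
  assert (aux : forall f g h : R -> R -> R, Ck2 1 I I' f -> Ck2 1 I I' g ->
    (forall y, f t y + e * g t y = h t y) ->
    Derive (fun y => h t y) s = D2 f t s + e * D2 g t s).
  { intros f g h Hf Hg E. apply is_derive_unique.
    eapply is_derive_ext; [exact E|].
    apply @is_derive_plus; [eapply Ck2_derive2; eauto|].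
    apply (is_derive_scal (fun y => g t y)). eapply Ck2_derive2; eauto. }
  unfold pd2 at 1. unfold C2Derive, CDerive.
  rewrite (aux _ _ (fun t s => Re (fst (variation X V e t s))) H1 K1),
    (aux _ _ (fun t s => Im (fst (variation X V e t s))) H2 K2),
    (aux _ _ (fun t s => Re (snd (variation X V e t s))) H3 K3),
    (aux _ _ (fun t s => Im (snd (variation X V e t s))) H4 K4);
  try (intros; unfold variation, C2add, C2scal, Re, Im; simpl; ring).
  unfold pd2, C2Derive, CDerive, C2add, C2scal, Cmult, Cplus, RtoC, D2. simpl.
  f_equal; f_equal; ring.
Qed.

Lemma continuous_sqrt_gdet (X : R -> R -> C2) (t s : R) :
  surface_Ck 1 I I' X -> I t -> I' s ->
  continuity_2d_pt (fun t s => sqrt (gdet X t s)) t s.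
Proof using hI hI'.
  intros HX It Is.
  apply (continuity_1d_2d_pt_comp sqrt (gdet X)).
  { apply continuity_pt_filterlim, continuous_sqrt. }
  assert (H1 := surface_Ck_pd1 0 X HX). assert (H2 := surface_Ck_pd2 0 X HX).
  apply (Ck2_continuity 0 I I'); [|exact It|exact Is].
  apply (Ck2_ext I I' hI hI') with (fun t s => gE X t s * gG X t s
     + (-1) * (gF X t s * gF X t s)).
  { intros. unfold gdet. ring. }
  assert (HE := Ck2_dot 0 _ _ H1 H1). assert (HF := Ck2_dot 0 _ _ H1 H2).
  assert (HG := Ck2_dot 0 _ _ H2 H2).
  apply (Ck2_plus I I' hI hI'); [now apply (Ck2_mult I I' hI hI')|].
  apply (Ck2_mult I I' hI hI' 0 (fun _ _ => -1)); [now apply Ck2_const|].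
  now apply (Ck2_mult I I' hI hI').
Qed.

(** In a conformal parametrization the derivative of the area density is half the
    derivative of E + G, because E = G and F = 0 to order zero. *)
Lemma first_variation_conformal (X V : R -> R -> C2) (t0 t1 s0 s1 : R) :
  I t0 -> I t1 -> t0 <= t1 -> I' s0 -> I' s1 -> s0 <= s1 ->
  surface_Ck 1 I I' X -> surface_Ck 1 I I' V ->
  (forall t s, I t -> I' s ->
     0 < gE X t s /\ gG X t s = gE X t s /\ gF X t s = 0) ->
  is_derive (fun e => area (variation X V e) t0 t1 s0 s1) 0
    (double_integral
       (fun t s => dot (pd1 X t s) (pd1 V t s) + dot (pd2 X t s) (pd2 V t s))
       t0 t1 s0 s1).
Proof using hI hI'.
  intros Ht0 Ht1 Ht Hs0 Hs1 Hs HX HV Hconf.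
  assert (X1 := surface_Ck_pd1 0 X HX). assert (X2 := surface_Ck_pd2 0 X HX).
  assert (V1 := surface_Ck_pd1 0 V HV). assert (V2 := surface_Ck_pd2 0 V HV).
  assert (Hvar : forall e, surface_Ck 1 I I' (variation X V e)).
  { intros e. apply surface_Ck_add; [exact HX|].
    apply (surface_Ck_scal 1 (fun _ _ => e)); [now apply Ck2_const|exact HV]. }
  assert (Pl := Ck2_plus I I' hI hI' 0). assert (Mu := Ck2_mult I I' hI hI' 0).
  assert (Co := Ck2_const I I' hI hI' 0).
  set (ab := fun t s => dot (pd1 X t s) (pd1 V t s)).
  set (cd := fun t s => dot (pd2 X t s) (pd2 V t s)).
  set (bb := fun t s => dot (pd1 V t s) (pd1 V t s)).
  set (dd := fun t s => dot (pd2 V t s) (pd2 V t s)).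
  set (bd := fun t s => dot (pd1 V t s) (pd2 V t s)).
  set (x := fun t s => dot (pd1 X t s) (pd2 V t s) + dot (pd1 V t s) (pd2 X t s)).
  assert (Cab : Ck2 0 I I' ab) by now apply Ck2_dot.
  assert (Ccd : Ck2 0 I I' cd) by now apply Ck2_dot.
  assert (Cbb : Ck2 0 I I' bb) by now apply Ck2_dot.
  assert (Cdd : Ck2 0 I I' dd) by now apply Ck2_dot.
  assert (Cbd : Ck2 0 I I' bd) by now apply Ck2_dot.
  assert (Cx : Ck2 0 I I' x) by (apply Pl; now apply Ck2_dot).
  assert (CE : Ck2 0 I I' (gE X)) by now apply Ck2_dot.
  set (q2 := fun t s => gE X t s * (dd t s + bb t s)
                        + (4 * (ab t s * cd t s) + (-1) * (x t s * x t s))).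
  set (q3 := fun t s => 2 * (ab t s * dd t s + cd t s * bb t s)
                        + (-2) * (x t s * bd t s)).
  set (q4 := fun t s => bb t s * dd t s + (-1) * (bd t s * bd t s)).
  (* The Gram determinant of the variation is a polynomial of degree 4 in e. *)
  assert (Hpoly : forall e t s, I t -> I' s ->
    gdet (variation X V e) t s = gE X t s ^ 2
      + 2 * e * gE X t s * (ab t s + cd t s)
      + e ^ 2 * (q2 t s + e * q3 t s + e ^ 2 * q4 t s)).
  { intros e t s It Is. destruct (Hconf t s It Is) as [_ [HG HF]].
    unfold gdet, gE at 1, gF at 1, gG at 1.
    rewrite pd1_variation, pd2_variation by assumption.
    rewrite !dot_add_scal.
    change (dot (pd1 X t s) (pd1 X t s)) with (gE X t s).
    change (dot (pd1 X t s) (pd2 X t s)) with (gF X t s).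
    change (dot (pd2 X t s) (pd2 X t s)) with (gG X t s).
    rewrite HG, HF.
    rewrite (dot_comm (pd1 V t s) (pd1 X t s)), (dot_comm (pd2 V t s) (pd2 X t s)).
    unfold q2, q3, q4, x, ab, cd, bb, dd, bd. ring. }
  assert (Cq2 : Ck2 0 I I' q2).
  { apply Pl; [apply Mu; auto|].
    apply Pl; (apply (Mu (fun _ _ => _)); [apply Co|now apply Mu]). }
  assert (Cq3 : Ck2 0 I I' q3).
  { apply Pl; (apply (Mu (fun _ _ => _)); [apply Co|]); auto. }
  assert (Cq4 : Ck2 0 I I' q4).
  { apply Pl; [now apply Mu|]. apply (Mu (fun _ _ => _)); [apply Co|]. now apply Mu. }
  assert (Cm : Ck2 0 I I' (fun t s => ab t s + cd t s)) by now apply Pl.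
  assert (Cinv : Ck2 0 I I' (fun t s => / gE X t s)).
  { apply (Ck2_inv I I' hI hI'); [|exact CE]. intros t s It Is.
    destruct (Hconf t s It Is). lra. }
  assert (Bd : forall f, Ck2 0 I I' f -> exists M, 0 < M /\
    forall t s, t0 <= t <= t1 -> s0 <= s <= s1 -> Rabs (f t s) <= M).
  { intros f Hf. apply bounded_on_rectangle; [exact Ht|exact Hs|].
    intros t s Ht' Hs'. apply (Ck2_continuity 0 I I' f Hf).
    - now apply (open_interval_between I t0 t1).
    - now apply (open_interval_between I' s0 s1). }
  destruct (Bd _ Cq2) as [M2 [P2 B2]]. destruct (Bd _ Cq3) as [M3 [P3 B3]].
  destruct (Bd _ Cq4) as [M4 [P4 B4]]. destruct (Bd _ Cm) as [Mm [Pm Bm]].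
  destruct (Bd _ Cinv) as [Mi [Pi Bi]].
  destruct (sqrt_taylor (/ Mi) (M2 + M3 + M4 + Mm)) as [d [K [Hd [HK Hest]]]].
  { now apply Rinv_0_lt_compat. } { lra. }
  apply (is_derive_double_integral I I' hI hI' t0 t1 s0 s1 Ht0 Ht1 Ht Hs0 Hs1 Hs
    (fun e t s => sqrt (gdet (variation X V e) t s)) _ d K).
  - lra.
  - exact HK.
  - intros e t s It Is. now apply continuous_sqrt_gdet.
  - intros t s It Is. now apply (Ck2_continuity 0 I I' _ Cm).
  - intros e t s He Ht' Hs'.
    assert (It : I t) by now apply (open_interval_between I t0 t1).
    assert (Is : I' s) by now apply (open_interval_between I' s0 s1).
    destruct (Hconf t s It Is) as [HE _].
    rewrite (Hpoly 0 t s It Is).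
    replace (gE X t s ^ 2 + _ + _) with (gE X t s ^ 2) by ring.
    rewrite (sqrt_pow2 (gE X t s)) by lra.
    apply Hest; [exact He| | |].
    + specialize (Bi t s Ht' Hs'). rewrite Rabs_pos_eq in Bi.
      2:{ now apply Rlt_le, Rinv_0_lt_compat. }
      rewrite <- (Rinv_inv (gE X t s)). apply Rinv_le_contravar; [|exact Bi].
      now apply Rinv_0_lt_compat.
    + specialize (Bm t s Ht' Hs'). unfold ab, cd in *. lra.
    + rewrite Hpoly by assumption.
      unfold ab, cd.
      match goal with |- Rabs ?y <= _ =>
        replace y with (e ^ 2 * (q2 t s + e * q3 t s + e ^ 2 * q4 t s)) by ring end.
      assert (He0 := pow2_ge_0 e).
      rewrite Rabs_mult, (Rabs_pos_eq (e ^ 2)), Rmult_comm by exact He0.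
      apply Rmult_le_compat_r; [exact He0|].
      specialize (B2 t s Ht' Hs'). specialize (B3 t s Ht' Hs').
      specialize (B4 t s Ht' Hs').
      assert (He1 : Rabs e <= 1) by lra.
      assert (He2 : e ^ 2 <= 1).
      { rewrite <- (pow2_abs e). generalize (Rabs_pos e). nra. }
      apply Rle_trans with (1 := Rabs_triang _ _).
      apply Rle_trans with (Rabs (q2 t s) + Rabs (e * q3 t s) + Rabs (e ^ 2 * q4 t s)).
      { apply Rplus_le_compat_r, Rabs_triang. }
      rewrite !Rabs_mult, (Rabs_pos_eq (e ^ 2)) by exact He0.
      generalize (Rabs_pos e) (Rabs_pos (q3 t s)) (Rabs_pos (q4 t s)). intros. nra.
Qed.

(** If the coordinate Laplacian of X, which in a conformal parametrization is a
    multiple of the mean curvature vector, equals J (p X_t + q X_s), then p dt + q ds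
    is the differential of the Lagrangian angle. The field J grad f is normal, so the
    first variation density is - <X_tt + X_ss, J grad f>; as J is an isometry, this
    is - <p X_t + q X_s, grad f>, where the conformal factor cancels. *)
Lemma hamiltonian_first_variation (X : R -> R -> C2) (p q f : R -> R -> R)
  (t0 t1 s0 s1 : R) :
  I t0 -> I t1 -> t0 <= t1 -> I' s0 -> I' s1 -> s0 <= s1 ->
  surface_Ck 2 I I' X -> Ck2 2 I I' f -> lagrangian I I' X ->
  (forall t s, I t -> I' s ->
     0 < gE X t s /\ gG X t s = gE X t s /\ gF X t s = 0) ->
  (forall t s, I t -> I' s ->
     C2add (pd1 (pd1 X) t s) (pd2 (pd2 X) t s)
     = J (C2add (C2scal (p t s) (pd1 X t s)) (C2scal (q t s) (pd2 X t s)))) ->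
  is_derive (fun e => area (variation X (hamiltonian_field X f) e) t0 t1 s0 s1) 0
    (double_integral (fun t s => - (p t s * D1 f t s + q t s * D2 f t s)) t0 t1 s0 s1).
Proof using hI hI'.
  intros Ht0 Ht1 Ht Hs0 Hs1 Hs HX Hf Hlag Hconf Hlap.
  assert (X1 := surface_Ck_pd1 1 X HX). assert (X2 := surface_Ck_pd2 1 X HX).
  assert (Pl := Ck2_plus I I' hI hI' 1). assert (Mu := Ck2_mult I I' hI hI' 1).
  set (V := hamiltonian_field X f).
  assert (CE : Ck2 1 I I' (gE X)) by now apply Ck2_dot.
  assert (CF : Ck2 1 I I' (gF X)) by now apply Ck2_dot.
  assert (CG : Ck2 1 I I' (gG X)) by now apply Ck2_dot.
  assert (Cdet : Ck2 1 I I' (fun t s => / gdet X t s)).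
  { apply (Ck2_inv I I' hI hI').
    - intros t s It Is. destruct (Hconf t s It Is) as [HE [HG HF]].
      unfold gdet. rewrite HG, HF. nra.
    - apply (Ck2_ext I I' hI hI') with (fun t s => gE X t s * gG X t s
        + (-1) * (gF X t s * gF X t s)).
      { intros. unfold gdet. ring. }
      apply Pl; [now apply Mu|].
      apply (Mu (fun _ _ => -1)); [now apply Ck2_const|now apply Mu]. }
  assert (Cf1 := Ck2_D1 1 I I' f Hf). assert (Cf2 := Ck2_D2 1 I I' f Hf).
  assert (Ccoef : forall g h k l : R -> R -> R, Ck2 1 I I' g -> Ck2 1 I I' h ->
    Ck2 1 I I' k -> Ck2 1 I I' l ->
    Ck2 1 I I' (fun t s => (g t s * h t s - k t s * l t s) / gdet X t s)).
  { intros g h k l Hg Hh Hk Hl. apply (Mu (fun t s => g t s * h t s - k t s * l t s));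
      [|exact Cdet].
    apply (Ck2_ext I I' hI hI') with (fun t s => g t s * h t s + (-1) * (k t s * l t s)).
    { intros. ring. }
    apply Pl; [now apply Mu|].
    apply (Mu (fun _ _ => -1)); [now apply Ck2_const|now apply Mu]. }
  assert (HV : surface_Ck 1 I I' V).
  { apply surface_Ck_J, surface_Ck_add; (apply surface_Ck_scal; [|assumption]);
    now apply Ccoef. }
  assert (O1 : forall t s, I t -> I' s -> dot (pd1 X t s) (V t s) = 0).
  { intros t s It Is. unfold V, hamiltonian_field, grad.
    rewrite dot_J_span_l, (Hlag t s It Is). ring. }
  assert (O2 : forall t s, I t -> I' s -> dot (pd2 X t s) (V t s) = 0).
  { intros t s It Is. unfold V, hamiltonian_field, grad.
    rewrite dot_J_span_r, (Hlag t s It Is). ring. }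
  rewrite <- (double_integral_ext I I' hI hI' t0 t1 s0 s1 Ht0 Ht1 Ht Hs0 Hs1 Hs
    (fun t s => dot (pd1 X t s) (pd1 V t s) + dot (pd2 X t s) (pd2 V t s))).
  { apply first_variation_conformal; auto. now apply surface_Ck_S. }
  intros t s It Is.
  rewrite (pd1_dot_orthogonal (pd1 X) V), (pd2_dot_orthogonal (pd2 X) V) by assumption.
  (* The mean curvature term: only X_tt + X_ss is left. *)
  replace (_ + _) with (- (dot (pd1 (pd1 X) t s) (V t s) + dot (pd2 (pd2 X) t s) (V t s)))
    by ring.
  rewrite <- dot_add_l, Hlap by assumption.
  unfold V, hamiltonian_field, grad. rewrite dot_J_span.
  change (dot (pd1 X t s) (pd1 X t s)) with (gE X t s).
  change (dot (pd1 X t s) (pd2 X t s)) with (gF X t s).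
  change (dot (pd2 X t s) (pd2 X t s)) with (gG X t s).
  destruct (Hconf t s It Is) as [HE [HG HF]].
  unfold gdet. rewrite HG, HF. field. lra.
Qed.

End Surfaces.

(** * Legendre curves and their curvature *)

(** Both kinds of curves are the case sg = 1 and sg = -1 of one notion: unit speed
    Legendre curves on the quadric |z|^2 + sg |w|^2 = sg for the Hermitian form of the
    same signature. *)
Definition legendre (sg : R) (I : R -> Prop) (z w : R -> C) : Prop :=
  smooth_curve I z /\ smooth_curve I w /\
  forall s, I s ->
    Cmod (z s) ^ 2 + sg * Cmod (w s) ^ 2 = sg /\
    Cmod (CDerive z s) ^ 2 + sg * Cmod (CDerive w s) ^ 2 = 1 /\
    (CDerive z s * Cconj (z s) + sg * (CDerive w s * Cconj (w s)))%C = RtoC 0.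

(** The product with the conjugate of [Ci * u] has the real part that the product with
    the conjugate of [u] has as imaginary part. *)
Definition curvature (sg : R) (z w : R -> C) (s : R) : R :=
  Im (CDerive (CDerive z) s * Cconj (CDerive z s)
      + sg * (CDerive (CDerive w) s * Cconj (CDerive w s)))%C.

Lemma legendre_S3 (I : R -> Prop) (g1 g2 : R -> C) :
  unit_legendre_S3 I g1 g2 -> legendre 1 I g1 g2.
Proof.
  intros [H1 [H2 H]]. split; [exact H1|]. split; [exact H2|].
  intros s Is. destruct (H s Is) as [A [B C]].
  rewrite !Rmult_1_l, Cmult_1_l. auto.
Qed.

Lemma legendre_H31 (I : R -> Prop) (a1 a2 : R -> C) :
  unit_legendre_H31 I a1 a2 -> legendre (-1) I a1 a2.
Proof.
  intros [H1 [H2 H]]. split; [exact H1|]. split; [exact H2|].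
  intros s Is. destruct (H s Is) as [A [B C]].
  split; [lra|]. split; [lra|]. rewrite <- C. apply injective_projections; simpl; ring.
Qed.

Lemma curvature_S3_eq (g1 g2 : R -> C) (s : R) :
  curvature_S3 g1 g2 s = curvature 1 g1 g2 s.
Proof. unfold curvature_S3, curvature, Re, Im. simpl. ring. Qed.

Lemma curvature_H31_eq (a1 a2 : R -> C) (s : R) :
  curvature_H31 a1 a2 s = curvature (-1) a1 a2 s.
Proof. unfold curvature_H31, curvature, Re, Im. simpl. ring. Qed.

Lemma smooth_curve_Re (I : R -> Prop) (z : R -> C) :
  smooth_curve I z -> smooth_on I (fun x => Re (z x)).
Proof. intros H n x Ix. now apply H. Qed.

Lemma smooth_curve_Im (I : R -> Prop) (z : R -> C) :
  smooth_curve I z -> smooth_on I (fun x => Im (z x)).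
Proof. intros H n x Ix. now apply H. Qed.

Lemma smooth_curve_CDerive (I : R -> Prop) (z : R -> C) :
  smooth_curve I z -> smooth_curve I (CDerive z).
Proof.
  intros H n x Ix. split.
  - exact (smooth_on_Derive I _ (smooth_curve_Re I z H) n x Ix).
  - exact (smooth_on_Derive I _ (smooth_curve_Im I z H) n x Ix).
Qed.

Lemma Cmod_sqr (z : C) : Cmod z ^ 2 = Re z ^ 2 + Im z ^ 2.
Proof. unfold Cmod, Re, Im. apply pow2_sqrt. nra. Qed.

Lemma RtoC_m1 : RtoC (-1) = (- RtoC 1)%C.
Proof. apply injective_projections; simpl; ring. Qed.

Section LegendreCurve.

Context (sg : R) (hsg : sg * sg = 1) (I : R -> Prop) (hI : is_open_interval I)
  (z w : R -> C) (hzw : legendre sg I z w).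

(** The rows (z, w) and (z', w') are orthonormal up to signs for the form
    |z|^2 + sg |w|^2, so one modulus determines those of all the entries, as in a
    unitary matrix of size 2. *)
Lemma legendre_moduli (s : R) : I s ->
  Cmod (w s) ^ 2 = 1 - sg * Cmod (z s) ^ 2 /\
  Cmod (CDerive z s) ^ 2 = 1 - sg * Cmod (z s) ^ 2 /\
  Cmod (CDerive w s) ^ 2 = Cmod (z s) ^ 2.
Proof using hsg hzw.
  intros Is. destruct hzw as [_ [_ H]]. destruct (H s Is) as [A [B C]].
  assert (C' : (CDerive z s * Cconj (z s))%C = (- sg * (CDerive w s * Cconj (w s)))%C).
  { replace (CDerive z s * Cconj (z s))%C with
      ((CDerive z s * Cconj (z s) + sg * (CDerive w s * Cconj (w s)))
       + - sg * (CDerive w s * Cconj (w s)))%C by ring.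
    rewrite C. ring. }
  apply (f_equal (fun c => Cmod c ^ 2)) in C'.
  rewrite <- RtoC_opp, !Cmod_mult, !Cmod_conj, Cmod_R, !Rpow_mult_distr in C'.
  rewrite pow2_abs in C'.
  set (a := Cmod (z s) ^ 2) in *. set (b := Cmod (w s) ^ 2) in *.
  set (c := Cmod (CDerive z s) ^ 2) in *. set (d := Cmod (CDerive w s) ^ 2) in *.
  assert (Eb : b = 1 - sg * a).
  { replace b with (sg * sg * b) by (rewrite hsg; ring).
    replace (sg * sg * b) with (sg * (a + sg * b) - sg * a) by ring.
    rewrite A, hsg. reflexivity. }
  assert (Ec : c = 1 - sg * d) by lra.
  replace ((- sg) ^ 2) with (sg * sg) in C' by ring.
  rewrite hsg, Rmult_1_l, Ec, Eb in C'.
  assert (Ed : d = a) by nra.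
  repeat split; [exact Eb| |exact Ed]. now rewrite Ec, Ed.
Qed.

(** A vector orthogonal to both rows of a matrix vanishes when the determinant D of
    the matrix does not; here |D| = 1 by the Lagrange identity. *)
Lemma orthogonal_to_frame_eq_0 (a b c d v1 v2 : C) :
  Cmod a ^ 2 + sg * Cmod b ^ 2 = sg ->
  Cmod c ^ 2 + sg * Cmod d ^ 2 = 1 ->
  (c * Cconj a + sg * (d * Cconj b))%C = RtoC 0 ->
  (v1 * Cconj a + sg * (v2 * Cconj b))%C = RtoC 0 ->
  (v1 * Cconj c + sg * (v2 * Cconj d))%C = RtoC 0 ->
  v1 = RtoC 0 /\ v2 = RtoC 0.
Proof using hsg.
  intros H1 H2 H3 H4 H5.
  set (D := (Cconj a * Cconj d - Cconj b * Cconj c)%C).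
  assert (HD : Cmod D ^ 2 = 1).
  { rewrite !Cmod_sqr in *.
    assert (E1 := f_equal fst H3). assert (E2 := f_equal snd H3).
    unfold D. destruct a as [a1 a2], b as [b1 b2], c as [c1 c2], d as [d1 d2].
    unfold Re, Im in *. simpl in *.
    (* The Lagrange identity |D|^2 = sg (|(a,b)|^2 |(c,d)|^2 - |<c,a>|^2). *)
    match goal with |- ?L = 1 => replace L with
      (sg * ((a1 * (a1 * 1) + a2 * (a2 * 1) + sg * (b1 * (b1 * 1) + b2 * (b2 * 1)))
             * (c1 * (c1 * 1) + c2 * (c2 * 1) + sg * (d1 * (d1 * 1) + d2 * (d2 * 1)))
      - (c1 * a1 - c2 * - a2 + (sg * (d1 * b1 - d2 * - b2) - 0 * (d1 * - b2 + d2 * b1))) ^ 2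
      - (c1 * - a2 + c2 * a1 + (sg * (d1 * - b2 + d2 * b1) + 0 * (d1 * b1 - d2 * - b2))) ^ 2)
      + (1 - sg * sg) * ((a1 * d1 - a2 * d2 - b1 * c1 + b2 * c2) ^ 2
                         + (a1 * d2 + a2 * d1 - b1 * c2 - b2 * c1) ^ 2)) by ring end.
    rewrite E1, E2, H1, H2, hsg. ring [hsg]. }
  assert (HD0 : D <> RtoC 0).
  { intros E. rewrite E, Cmod_0 in HD. lra. }
  assert (Hsg : RtoC sg <> RtoC 0).
  { intros E. apply RtoC_inj in E. rewrite E in hsg. lra. }
  assert (K1 : (v1 * D)%C = RtoC 0).
  { replace (v1 * D)%C with ((v1 * Cconj a + sg * (v2 * Cconj b)) * Cconj d
      - (v1 * Cconj c + sg * (v2 * Cconj d)) * Cconj b)%C by (unfold D; ring).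
    rewrite H4, H5. ring. }
  assert (K2 : (v2 * (sg * D))%C = RtoC 0).
  { replace (v2 * (sg * D))%C with ((v1 * Cconj c + sg * (v2 * Cconj d)) * Cconj a
      - (v1 * Cconj a + sg * (v2 * Cconj b)) * Cconj c)%C by (unfold D; ring).
    rewrite H4, H5. ring. }
  split.
  - replace v1 with (v1 * D * / D)%C by (field; exact HD0). rewrite K1. ring.
  - replace v2 with (v2 * (sg * D) * / (sg * D))%C by (field; split; assumption).
    rewrite K2. ring.
Qed.

Lemma quadratic_constraint_derive (f1 f2 f3 f4 h1 h2 h3 h4 : R -> R) (c s : R) :
  smooth_on I f1 -> smooth_on I f2 -> smooth_on I f3 -> smooth_on I f4 ->
  smooth_on I h1 -> smooth_on I h2 -> smooth_on I h3 -> smooth_on I h4 ->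
  (forall s, I s -> f1 s * h1 s + f2 s * h2 s + sg * (f3 s * h3 s + f4 s * h4 s) = c) ->
  I s ->
  Derive f1 s * h1 s + f1 s * Derive h1 s + (Derive f2 s * h2 s + f2 s * Derive h2 s)
  + sg * (Derive f3 s * h3 s + f3 s * Derive h3 s
          + (Derive f4 s * h4 s + f4 s * Derive h4 s)) = 0.
Proof using hI.
  intros F1 F2 F3 F4 K1 K2 K3 K4 E Is.
  assert (aux : forall f h, smooth_on I f -> smooth_on I h ->
    is_derive (fun s => f s * h s) s (Derive f s * h s + f s * Derive h s)).
  { intros f h Hf Hh. apply (is_derive_mult f h);
      [now apply (smooth_on_derive I)|now apply (smooth_on_derive I)|apply Rmult_comm]. }
  rewrite <- (Derive_const c s).
  rewrite <- (Derive_ext_loc _ _ s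
    (filter_imp _ _ (fun s => E s) (open_interval_locally I s hI Is))).
  symmetry. apply is_derive_unique.
  apply @is_derive_plus; [apply @is_derive_plus; now apply aux|].
  apply (is_derive_scal (fun s => f3 s * h3 s + f4 s * h4 s)).
  apply @is_derive_plus; now apply aux.
Qed.

Lemma hermitian_constraint_derive (a1 a2 b1 b2 : R -> C) (c : C) (s : R) :
  smooth_curve I a1 -> smooth_curve I a2 -> smooth_curve I b1 -> smooth_curve I b2 ->
  (forall s, I s -> (a1 s * Cconj (b1 s) + sg * (a2 s * Cconj (b2 s)))%C = c) ->
  I s ->
  ((CDerive a1 s * Cconj (b1 s) + sg * (CDerive a2 s * Cconj (b2 s)))
   + (a1 s * Cconj (CDerive b1 s) + sg * (a2 s * Cconj (CDerive b2 s))))%C = RtoC 0.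
Proof using hI.
  intros Ha1 Ha2 Hb1 Hb2 E Is.
  assert (Hopp : forall b, smooth_curve I b -> smooth_on I (fun s => - Im (b s))).
  { intros b Hb n x Ix. now apply ex_derive_n_opp, Hb. }
  assert (SR := smooth_curve_Re I). assert (SI := smooth_curve_Im I).
  assert (DR := quadratic_constraint_derive _ _ _ _ _ _ _ _ (Re c) s
    (SR _ Ha1) (SI _ Ha1) (SR _ Ha2) (SI _ Ha2) (SR _ Hb1) (SI _ Hb1) (SR _ Hb2) (SI _ Hb2)).
  assert (DI := quadratic_constraint_derive _ _ _ _ _ _ _ _ (Im c) s
    (SI _ Ha1) (SR _ Ha1) (SI _ Ha2) (SR _ Ha2)
    (SR _ Hb1) (Hopp _ Hb1) (SR _ Hb2) (Hopp _ Hb2)).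
  rewrite !Derive_opp in DI. cbv beta in DR, DI.
  apply injective_projections.
  - refine (eq_trans _ (DR _ Is)).
    + unfold CDerive, Re, Im. simpl. ring.
    + intros x Ix. rewrite <- (E x Ix). unfold Re, Im. simpl. ring.
  - refine (eq_trans _ (DI _ Is)).
    + unfold CDerive, Re, Im. simpl. ring.
    + intros x Ix. rewrite <- (E x Ix). unfold Re, Im. simpl. ring.
Qed.

(** The curve and its velocity are orthonormal up to signs; differentiating the
    constraints gives the Hermitian products of the acceleration with both, and hence
    its coordinates. *)
Lemma legendre_equation (s : R) : I s ->
  CDerive (CDerive z) s
  = (Ci * curvature sg z w s * CDerive z s + - (sg * z s))%C /\
  CDerive (CDerive w) s
  = (Ci * curvature sg z w s * CDerive w s + - (sg * w s))%C.
Proof using hsg hI hzw.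
  intros Is. assert (hzw' := hzw). destruct hzw' as [Hz [Hw H]].
  assert (Hz' := smooth_curve_CDerive I z Hz). assert (Hw' := smooth_curve_CDerive I w Hw).
  assert (Hmod : forall a b : C, (a * Cconj a + sg * (b * Cconj b))%C
                           = RtoC (Cmod a ^ 2 + sg * Cmod b ^ 2)).
  { intros a b. rewrite !Cmod_sqr. apply injective_projections; simpl;
    unfold Re, Im; ring. }
  assert (N0 : forall x, I x ->
    (z x * Cconj (z x) + sg * (w x * Cconj (w x)))%C = RtoC sg).
  { intros x Ix. rewrite Hmod. f_equal. apply (H x Ix). }
  assert (N1 : forall x, I x ->
    (CDerive z x * Cconj (CDerive z x) + sg * (CDerive w x * Cconj (CDerive w x)))%C
    = RtoC 1).
  { intros x Ix. rewrite Hmod. f_equal. apply (H x Ix). }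
  assert (N2 : forall x, I x ->
    (CDerive z x * Cconj (z x) + sg * (CDerive w x * Cconj (w x)))%C = RtoC 0).
  { intros x Ix. apply (H x Ix). }
  assert (dN1 := hermitian_constraint_derive _ _ _ _ _ s Hz' Hw' Hz' Hw' N1 Is).
  assert (dN2 := hermitian_constraint_derive _ _ _ _ _ s Hz' Hw' Hz Hw N2 Is).
  specialize (N0 s Is). specialize (N1 s Is). specialize (N2 s Is).
  rewrite N1 in dN2.
  set (k := curvature sg z w s).
  assert (Hk : (CDerive (CDerive z) s * Cconj (CDerive z s)
                + sg * (CDerive (CDerive w) s * Cconj (CDerive w s)))%C = (Ci * k)%C).
  { apply injective_projections; simpl.
    - apply (f_equal fst) in dN1. simpl in dN1. lra.
    - unfold k, curvature, CDerive, Re, Im. simpl. ring. }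
  assert (Hc : (z s * Cconj (CDerive z s) + sg * (w s * Cconj (CDerive w s)))%C = RtoC 0).
  { assert (N3 := f_equal fst N2). assert (N4 := f_equal snd N2). simpl in N3, N4.
    apply injective_projections; simpl; lra. }
  set (v1 := (CDerive (CDerive z) s + - (Ci * k * CDerive z s + - (sg * z s)))%C).
  set (v2 := (CDerive (CDerive w) s + - (Ci * k * CDerive w s + - (sg * w s)))%C).
  assert (Hv : v1 = RtoC 0 /\ v2 = RtoC 0).
  { destruct (H s Is) as [A [B F]].
    apply (orthogonal_to_frame_eq_0 (z s) (w s) (CDerive z s) (CDerive w s)); auto.
    - replace (v1 * Cconj (z s) + sg * (v2 * Cconj (w s)))%C with
        ((CDerive (CDerive z) s * Cconj (z s)
                + sg * (CDerive (CDerive w) s * Cconj (w s))) + 1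
         - Ci * k * (CDerive z s * Cconj (z s) + sg * (CDerive w s * Cconj (w s)))
         + (sg * (z s * Cconj (z s) + sg * (w s * Cconj (w s))) - 1))%C
        by (unfold v1, v2; ring).
      rewrite dN2, N2, N0, <- RtoC_mult, hsg. ring.
    - replace (v1 * Cconj (CDerive z s) + sg * (v2 * Cconj (CDerive w s)))%C with
        ((CDerive (CDerive z) s * Cconj (CDerive z s)
                + sg * (CDerive (CDerive w) s * Cconj (CDerive w s)))
         - Ci * k * (CDerive z s * Cconj (CDerive z s)
                     + sg * (CDerive w s * Cconj (CDerive w s)))
         + sg * (z s * Cconj (CDerive z s) + sg * (w s * Cconj (CDerive w s))))%C
        by (unfold v1, v2; ring).
      rewrite Hk, N1, Hc. ring. }
  destruct Hv as [V1 V2]. split.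
  - rewrite <- (Cplus_0_r (Ci * _ * CDerive z s + _)), <- V1. unfold v1. ring.
  - rewrite <- (Cplus_0_r (Ci * _ * CDerive w s + _)), <- V2. unfold v2. ring.
Qed.

Lemma legendre_curvature_smooth (s : R) : I s ->
  is_derive (curvature sg z w) s (Derive (curvature sg z w) s) /\
  continuous (Derive (curvature sg z w)) s.
Proof using hI hzw.
  intros Is. destruct hzw as [Hz [Hw _]].
  assert (Hz' := smooth_curve_CDerive I z Hz). assert (Hw' := smooth_curve_CDerive I w Hw).
  assert (Hz'' := smooth_curve_CDerive I _ Hz').
  assert (Hw'' := smooth_curve_CDerive I _ Hw').
  assert (Pl := Ck2_plus I I hI hI 1). assert (Mu := Ck2_mult I I hI hI 1).
  assert (Fc := Ck2_snd I I hI hI 1). assert (Co := Ck2_const I I hI hI 1).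
  assert (K : forall u, smooth_curve I u -> smooth_curve I (CDerive u) ->
    Ck2 1 I I (fun _ s => Im (CDerive u s) * Re (u s) + (-1) * (Re (CDerive u s) * Im (u s)))).
  { intros u Hu Hu'.
    destruct (conj (smooth_curve_Re I u Hu) (smooth_curve_Im I u Hu)) as [U1 U2].
    destruct (conj (smooth_curve_Re I _ Hu') (smooth_curve_Im I _ Hu')) as [U1' U2'].
    apply Pl; [apply Mu; now apply Fc|].
    apply (Mu (fun _ _ => -1)); [apply Co|apply Mu; now apply Fc]. }
  assert (Ck : Ck2 1 I I (fun _ s => curvature sg z w s)).
  { eapply (Ck2_ext I I hI hI 1);
      [|exact (Pl _ _ (K _ Hz' Hz'') (Mu _ _ (Co sg) (K _ Hw' Hw'')))].
    intros t x _ _. unfold curvature, Re, Im. simpl. ring. }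
  split.
  - exact (Ck2_derive2 0 I I _ Ck s s Is Is).
  - apply (continuity_2d_pt_snd (fun _ s => Derive (curvature sg z w) s) s s).
    exact (Ck2_continuity 0 I I _ (Ck2_D2 0 I I _ Ck) s s Is Is).
Qed.

End LegendreCurve.

(** * The product of two Legendre curves *)

Section Product.

Context (I I' : R -> Prop) (hI : is_open_interval I) (hI' : is_open_interval I').

Lemma surface_Ck_product (n : nat) (a1 a2 g1 g2 : R -> C) :
  smooth_curve I a1 -> smooth_curve I a2 -> smooth_curve I' g1 -> smooth_curve I' g2 ->
  surface_Ck n I I' (product_surface a1 a2 g1 g2).
Proof using hI hI'.
  intros A1 A2 G1 G2.
  assert (Pl := Ck2_plus I I' hI hI' n). assert (Mu := Ck2_mult I I' hI hI' n).
  assert (Co := Ck2_const I I' hI hI' n).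
  assert (F1 := Ck2_fst I I' hI hI' n). assert (F2 := Ck2_snd I I' hI hI' n).
  assert (M : forall f g, smooth_on I f -> smooth_on I' g ->
    Ck2 n I I' (fun t s => f t * g s)).
  { intros f g Hf Hg. apply (Mu (fun t _ => f t) (fun _ s => g s));
      [now apply F1|now apply F2]. }
  assert (SR := smooth_curve_Re). assert (SI := smooth_curve_Im).
  assert (KR : forall u v, smooth_curve I u -> smooth_curve I' v ->
    Ck2 n I I' (fun t s => Re (u t * v s)%C)).
  { intros u v Hu Hv. eapply (Ck2_ext I I' hI hI' n);
    [|exact (Pl _ _ (M _ _ (SR I u Hu) (SR I' v Hv))
                (Mu _ _ (Co (-1)) (M _ _ (SI I u Hu) (SI I' v Hv))))].
    intros. unfold Re, Im. simpl. ring. }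
  assert (KI : forall u v, smooth_curve I u -> smooth_curve I' v ->
    Ck2 n I I' (fun t s => Im (u t * v s)%C)).
  { intros u v Hu Hv.
    exact (Pl _ _ (M _ _ (SR I u Hu) (SI I' v Hv)) (M _ _ (SI I u Hu) (SR I' v Hv))). }
  exact (conj (KR _ _ A1 G1) (conj (KI _ _ A1 G1) (conj (KR _ _ A2 G2) (KI _ _ A2 G2)))).
Qed.

Lemma CDerive_mult_const (J : R -> Prop) (z : R -> C) (c : C) (x : R) :
  smooth_curve J z -> J x -> CDerive (fun y => (z y * c)%C) x = (CDerive z x * c)%C.
Proof using.
  intros Hz Jx.
  assert (dRe := smooth_on_derive J _ x (smooth_curve_Re J z Hz) Jx).
  assert (dIm := smooth_on_derive J _ x (smooth_curve_Im J z Hz) Jx).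
  apply injective_projections; apply is_derive_unique.
  - eapply is_derive_ext; [|eapply (eq_ind _ (is_derive _ x)
      (is_derive_plus _ _ _ _ _ (is_derive_scal _ _ (fst c) _ dRe)
                                (is_derive_scal _ _ (- snd c) _ dIm)))].
    + intros y. unfold plus, Re, Im. simpl. unfold Re, Im. ring.
    + unfold plus, Re, Im. simpl. unfold Re, Im. ring.
  - eapply is_derive_ext; [|eapply (eq_ind _ (is_derive _ x)
      (is_derive_plus _ _ _ _ _ (is_derive_scal _ _ (snd c) _ dRe)
                                (is_derive_scal _ _ (fst c) _ dIm)))].
    + intros y. unfold plus, Re, Im. simpl. unfold Re, Im. ring.
    + unfold plus, Re, Im. simpl. unfold Re, Im. ring.
Qed.

Lemma pd1_product (a1 a2 g1 g2 : R -> C) (t s : R) :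
  smooth_curve I a1 -> smooth_curve I a2 -> I t ->
  pd1 (product_surface a1 a2 g1 g2) t s
  = product_surface (CDerive a1) (CDerive a2) g1 g2 t s.
Proof using.
  intros A1 A2 It. unfold pd1, C2Derive, product_surface. simpl.
  now rewrite !(CDerive_mult_const I).
Qed.

Lemma pd2_product (a1 a2 g1 g2 : R -> C) (t s : R) :
  smooth_curve I' g1 -> smooth_curve I' g2 -> I' s ->
  pd2 (product_surface a1 a2 g1 g2) t s
  = product_surface a1 a2 (CDerive g1) (CDerive g2) t s.
Proof using.
  intros G1 G2 Is. unfold pd2, C2Derive, product_surface. simpl.
  assert (E : forall c z, smooth_curve I' z ->
    CDerive (fun y => (c * z y)%C) s = (c * CDerive z s)%C).
  { intros c z Hz. rewrite Cmult_comm, <- (CDerive_mult_const I') by assumption.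
    unfold CDerive. f_equal; apply Derive_ext; intros y; now rewrite Cmult_comm. }
  now rewrite !E.
Qed.

Lemma pd1_ext (X Y : R -> R -> C2) (t s : R) :
  (forall t s, I t -> I' s -> X t s = Y t s) -> I t -> I' s -> pd1 X t s = pd1 Y t s.
Proof using hI.
  intros E It Is. unfold pd1, C2Derive, CDerive.
  assert (L : locally t (fun x => X x s = Y x s)).
  { generalize (open_interval_locally I t hI It). apply filter_imp. auto. }
  f_equal; f_equal; apply Derive_ext_loc; generalize L; apply filter_imp;
    intros x Hx; now rewrite Hx.
Qed.

Lemma pd2_ext (X Y : R -> R -> C2) (t s : R) :
  (forall t s, I t -> I' s -> X t s = Y t s) -> I t -> I' s -> pd2 X t s = pd2 Y t s.
Proof using hI'.
  intros E It Is. unfold pd2, C2Derive, CDerive.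
  assert (L : locally s (fun y => X t y = Y t y)).
  { generalize (open_interval_locally I' s hI' Is). apply filter_imp. auto. }
  f_equal; f_equal; apply Derive_ext_loc; generalize L; apply filter_imp;
    intros x Hx; now rewrite Hx.
Qed.

Context (a1 a2 g1 g2 : R -> C)
  (halpha : legendre (-1) I a1 a2) (hgamma : legendre 1 I' g1 g2).

Notation X := (product_surface a1 a2 g1 g2).

Lemma product_pd1 (t s : R) : I t ->
  pd1 X t s = product_surface (CDerive a1) (CDerive a2) g1 g2 t s.
Proof using halpha.
  destruct halpha as [A1 [A2 _]]. intros It. now apply pd1_product.
Qed.

Lemma product_pd2 (t s : R) : I' s ->
  pd2 X t s = product_surface a1 a2 (CDerive g1) (CDerive g2) t s.
Proof using hgamma.
  destruct hgamma as [G1 [G2 _]]. intros Is. now apply pd2_product.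
Qed.

Lemma dot_self_product (u1 u2 v1 v2 : R -> C) (t s : R) :
  dot (product_surface u1 u2 v1 v2 t s) (product_surface u1 u2 v1 v2 t s)
  = Cmod (u1 t) ^ 2 * Cmod (v1 s) ^ 2 + Cmod (u2 t) ^ 2 * Cmod (v2 s) ^ 2.
Proof using.
  unfold dot, product_surface. rewrite !Cmod_sqr. unfold Re, Im. simpl. ring.
Qed.

(** The Legendre condition of the first curve makes a1' conj(a1) a common factor of
    the Hermitian product of X_t and X_s; the other factor vanishes by the Legendre
    condition of the second curve. Its real and imaginary parts are F and omega. *)
Lemma product_hermitian_orthogonal (t s : R) : I t -> I' s ->
  gF X t s = 0 /\ omega (pd1 X t s) (pd2 X t s) = 0.
Proof using halpha hgamma.
  intros It Is. unfold gF, omega. rewrite product_pd1, product_pd2 by assumption.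
  destruct halpha as [_ [_ HA]]. destruct hgamma as [_ [_ HG]].
  destruct (HA t It) as [_ [_ EA]]. destruct (HG s Is) as [_ [_ EG]].
  assert (E : (CDerive a1 t * g1 s * Cconj (a1 t * CDerive g1 s)
               + CDerive a2 t * g2 s * Cconj (a2 t * CDerive g2 s))%C = RtoC 0).
  { apply (f_equal Cconj) in EG.
    rewrite !Cplus_conj, !Cmult_conj, !Cconj_conj in EG.
    replace (Cconj (RtoC 1)) with (RtoC 1) in EG
      by (apply injective_projections; simpl; ring).
    replace (Cconj (RtoC 0)) with (RtoC 0) in EG
      by (apply injective_projections; simpl; ring).
    rewrite !Cmult_conj.
    assert (EA' : (CDerive a1 t * Cconj (a1 t))%C = (CDerive a2 t * Cconj (a2 t))%C).
    { rewrite <- (Cplus_0_r (CDerive a2 t * _)), <- EA, RtoC_m1. ring. }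
    transitivity ((CDerive a1 t * Cconj (a1 t)) * (g1 s * Cconj (CDerive g1 s))
      + (CDerive a2 t * Cconj (a2 t)) * (g2 s * Cconj (CDerive g2 s)))%C; [ring|].
    rewrite EA'.
    transitivity ((CDerive a2 t * Cconj (a2 t)) *
      (Cconj (CDerive g1 s) * g1 s + 1 * (Cconj (CDerive g2 s) * g2 s)))%C; [ring|].
    rewrite EG. ring. }
  split.
  - apply (f_equal Re) in E. exact E.
  - apply (f_equal Im) in E. unfold dot, J, product_surface, Re, Im in *.
    simpl in *. lra.
Qed.

(** Both coefficients are |a1|^2 + |g1|^2. *)
Lemma product_conformal (t s : R) : I t -> I' s -> gG X t s = gE X t s.
Proof using halpha hgamma.
  intros It Is. unfold gE, gG. rewrite product_pd1, product_pd2 by assumption.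
  rewrite !dot_self_product.
  destruct (legendre_moduli (-1) ltac:(ring) I a1 a2 halpha t It) as [A1 [A2 A3]].
  destruct (legendre_moduli 1 ltac:(ring) I' g1 g2 hgamma s Is) as [G1 [G2 G3]].
  rewrite A1, A2, A3, G1, G2, G3. ring.
Qed.

(** The zeroth order terms of the equations a'' = i k a' + a and g'' = i k g' - g
    cancel. *)
Lemma product_laplacian (t s : R) : I t -> I' s ->
  C2add (pd1 (pd1 X) t s) (pd2 (pd2 X) t s)
  = J (C2add (C2scal (curvature (-1) a1 a2 t) (pd1 X t s))
             (C2scal (curvature 1 g1 g2 s) (pd2 X t s))).
Proof using hI hI' halpha hgamma.
  intros It Is.
  destruct (legendre_equation (-1) ltac:(ring) I hI a1 a2 halpha t It) as [A1 A2].
  destruct (legendre_equation 1 ltac:(ring) I' hI' g1 g2 hgamma s Is) as [G1 G2].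
  rewrite (pd1_ext (pd1 X) (product_surface (CDerive a1) (CDerive a2) g1 g2))
    by (intros; auto using product_pd1).
  rewrite (pd2_ext (pd2 X) (product_surface a1 a2 (CDerive g1) (CDerive g2)))
    by (intros; auto using product_pd2).
  rewrite product_pd1, product_pd2 by assumption.
  destruct halpha as [Ha1 [Ha2 _]]. destruct hgamma as [Hg1 [Hg2 _]].
  rewrite pd1_product, pd2_product by auto using smooth_curve_CDerive.
  unfold product_surface, C2add, C2scal, J. cbn [fst snd].
  rewrite A1, A2, G1, G2, !RtoC_m1. f_equal; ring.
Qed.

Lemma immersion_gE_pos (t s : R) : immersion I I' X -> I t -> I' s -> 0 < gE X t s.
Proof using.
  intros H It Is. specialize (H t s It Is).
  unfold gE. destruct (pd1 X t s) as [[x1 x2] [x3 x4]].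
  destruct (pd2 X t s) as [[y1 y2] [y3 y4]].
  unfold dot, Re. simpl.
  apply Rnot_le_lt. intros Hle.
  assert (Ex1 : x1 = 0) by nra. assert (Ex2 : x2 = 0) by nra.
  assert (Ex3 : x3 = 0) by nra. assert (Ex4 : x4 = 0) by nra.
  destruct (H 1 0) as [E _]; [|lra].
  subst. unfold C2add, C2scal, C2zero, RtoC, Cmult, Cplus. simpl.
  f_equal; f_equal; ring.
Qed.

Lemma product_first_variation (f : R -> R -> R) (t0 t1 s0 s1 : R) :
  immersion I I' X -> I t0 -> I t1 -> t0 <= t1 -> I' s0 -> I' s1 -> s0 <= s1 ->
  Ck2 2 I I' f ->
  is_derive (fun e => area (variation X (hamiltonian_field X f) e) t0 t1 s0 s1) 0
    (double_integral (fun t s => - (curvature (-1) a1 a2 t * D1 f t s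
                                    + curvature 1 g1 g2 s * D2 f t s)) t0 t1 s0 s1).
Proof using hI hI' halpha hgamma.
  intros Him Ht0 Ht1 Ht Hs0 Hs1 Hs Hf.
  apply (hamiltonian_first_variation I I' hI hI' X
    (fun t _ => curvature (-1) a1 a2 t) (fun _ s => curvature 1 g1 g2 s)); auto.
  - destruct halpha as [Ha1 [Ha2 _]]. destruct hgamma as [Hg1 [Hg2 _]].
    now apply surface_Ck_product.
  - intros t s It Is. now apply product_hermitian_orthogonal.
  - intros t s It Is. split; [now apply immersion_gE_pos|].
    split; [now apply product_conformal|now apply product_hermitian_orthogonal].
  - exact product_laplacian.
Qed.

End Product.

(** * Integration by parts on a rectangle *)

Definition supported_in (t0 t1 s0 s1 : R) (f : R -> R -> R) : Prop :=
  forall t s, ~ (t0 <= t <= t1 /\ s0 <= s <= s1) -> f t s = 0.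

Lemma continuous_zero_left (f : R -> R) (x : R) :
  continuous f x -> (forall y, y < x -> f y = 0) -> f x = 0.
Proof.
  intros Hc H0. destruct (Req_dec (f x) 0) as [E|E]; [exact E|exfalso].
  apply continuity_pt_filterlim in Hc.
  destruct (Hc (Rabs (f x)) (Rabs_pos_lt _ E)) as [d [Hd Hf]].
  specialize (Hf (x - d / 2)). simpl in Hf. unfold Rdist in Hf.
  rewrite (H0 (x - d / 2)), Rminus_0_l, Rabs_Ropp in Hf by lra.
  apply (Rlt_irrefl (Rabs (f x))), Hf. split.
  - split; [exact Logic.I|lra].
  - rewrite Rabs_left; lra.
Qed.

Lemma continuous_zero_right (f : R -> R) (x : R) :
  continuous f x -> (forall y, x < y -> f y = 0) -> f x = 0.
Proof.
  intros Hc H0. rewrite <- (Ropp_involutive x).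
  apply (continuous_zero_left (fun y => f (- y))).
  - apply (continuous_comp Ropp f).
    + apply (continuous_opp (V := R_NormedModule) (fun y => y)), continuous_id.
    + now rewrite Ropp_involutive.
  - intros y Hy. apply H0. lra.
Qed.

Section Parts.

Context (I I' : R -> Prop) (hI : is_open_interval I) (hI' : is_open_interval I').
Context (t0 t1 s0 s1 : R) (Ht0 : I t0) (Ht1 : I t1) (Ht : t0 <= t1)
  (Hs0 : I' s0) (Hs1 : I' s1) (Hs : s0 <= s1).

Lemma double_integral_D2_supported (g : R -> R -> R) :
  Ck2 1 I I' g -> supported_in t0 t1 s0 s1 g ->
  double_integral (D2 g) t0 t1 s0 s1 = 0.
Proof using hI hI' Ht0 Ht1 Ht Hs0 Hs1 Hs.
  intros Hg H0. unfold double_integral.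
  rewrite (RInt_ext (V := R_CompleteNormedModule) _ (fun _ => 0)).
  { rewrite RInt_const. apply Rmult_0_r. }
  rewrite Rmin_left, Rmax_right by exact Ht. intros t Ht'.
  assert (It : I t) by (apply (open_interval_between I t0 t1); auto; lra).
  assert (Hin : forall s, s0 <= s <= s1 -> I' s)
    by (intros s Hs'; now apply (open_interval_between I' s0 s1)).
  transitivity (g t s1 - g t s0).
  - apply (RInt_Derive (g t)); rewrite Rmin_left, Rmax_right by exact Hs;
      intros s Hs'.
    + eexists. apply (Ck2_derive2 0 I I' g Hg); auto.
    + apply (continuity_2d_pt_snd (D2 g)).
      apply (Ck2_continuity 0 I I' _ (Ck2_D2 0 I I' g Hg)); auto.
  - assert (Hc : forall s, I' s -> continuous (g t) s).
    { intros s Is. apply continuity_2d_pt_snd, (Ck2_continuity 1 I I' g Hg); auto. }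
    rewrite (continuous_zero_left (g t) s0), (continuous_zero_right (g t) s1); auto.
    + apply Rminus_0_r.
    + intros s Hs'. apply H0. lra.
    + intros s Hs'. apply H0. lra.
Qed.

(** The inner integral of g is a function of t whose derivative is the inner integral
    of its t-derivative, and it vanishes at both ends because g, being continuous,
    vanishes on the boundary of the rectangle. *)
Lemma double_integral_D1_supported (g : R -> R -> R) :
  Ck2 1 I I' g -> supported_in t0 t1 s0 s1 g ->
  double_integral (D1 g) t0 t1 s0 s1 = 0.
Proof using hI hI' Ht0 Ht1 Ht Hs0 Hs1 Hs.
  intros Hg H0.
  assert (Hc1 := Ck2_continuity 0 I I' _ (Ck2_D1 0 I I' g Hg)).
  assert (Hc := Ck2_continuity 1 I I' g Hg).
  set (F := fun t => RInt (g t) s0 s1).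
  assert (Hin : forall s, s0 <= s <= s1 -> I' s)
    by (intros s Hs'; now apply (open_interval_between I' s0 s1)).
  assert (HF : forall t, I t -> is_derive F t (RInt (D1 g t) s0 s1)).
  { intros t It. apply (is_derive_RInt_param g s0 s1 t).
    - generalize (open_interval_locally I t hI It). apply filter_imp.
      rewrite Rmin_left, Rmax_right by exact Hs. intros x Ix s Hs'.
      eexists. apply (Ck2_derive1 0 I I' g Hg); auto.
    - rewrite Rmin_left, Rmax_right by exact Hs. intros s Hs'. apply Hc1; auto.
    - generalize (open_interval_locally I t hI It). apply filter_imp.
      intros x Ix. exact (inner_ex_RInt I I' hI' s0 s1 Hs0 Hs1 Hs g x Hc Ix). }
  assert (Hedge : forall t, I t -> (t = t0 \/ t = t1) -> F t = 0).
  { intros t It Ht'. unfold F.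
    rewrite (RInt_ext (V := R_CompleteNormedModule) _ (fun _ => 0)).
    { rewrite RInt_const. apply Rmult_0_r. }
    rewrite Rmin_left, Rmax_right by exact Hs. intros s Hs'.
    assert (Hcs : continuous (fun x => g x s) t).
    { apply (ex_derive_continuous (fun x => g x s)). eexists.
      apply (Ck2_derive1 0 I I' g Hg); [exact It|apply Hin; lra]. }
    destruct Ht' as [-> | ->].
    - apply (continuous_zero_left (fun x => g x s) t0 Hcs). intros x Hx. apply H0. lra.
    - apply (continuous_zero_right (fun x => g x s) t1 Hcs). intros x Hx. apply H0. lra. }
  transitivity (F t1 - F t0).
  2:{ rewrite !Hedge by auto. ring. }
  unfold double_integral. apply is_RInt_unique, (is_RInt_derive F);
    rewrite Rmin_left, Rmax_right by exact Ht; intros t Ht'.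
  - apply HF. now apply (open_interval_between I t0 t1).
  - apply (continuous_inner_RInt I I' hI hI' s0 s1 Hs0 Hs1 Hs (D1 g) t Hc1).
    now apply (open_interval_between I t0 t1).
Qed.

Definition C1_on (J : R -> Prop) (p : R -> R) : Prop :=
  forall x, J x -> is_derive p x (Derive p x) /\ continuous (Derive p) x.

Lemma C1_on_Ck2_fst (p : R -> R) : C1_on I p -> Ck2 1 I I' (fun t _ => p t).
Proof using hI hI'.
  intros Hp.
  assert (K : forall h, (forall x, I x -> continuous h x) -> Ck2 0 I I' (fun t _ => h t)).
  { intros h Hh. split; [|exact Logic.I]. intros t s It Is.
    now apply continuity_2d_pt_fst_of, Hh. }
  apply (Ck2_step I I' hI hI') with (fun t _ => Derive p t) (fun _ _ => 0).
  - apply Ck2_continuity with 0%nat, K. intros x Ix.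
    apply (ex_derive_continuous p). eexists. now apply Hp.
  - intros t s It Is. now apply Hp.
  - intros t s It Is. apply @is_derive_const.
  - apply K. intros x Ix. now apply Hp.
  - now apply Ck2_const.
Qed.

Lemma C1_on_Ck2_snd (p : R -> R) : C1_on I' p -> Ck2 1 I I' (fun _ s => p s).
Proof using hI hI'.
  intros Hp.
  assert (K : forall h, (forall x, I' x -> continuous h x) -> Ck2 0 I I' (fun _ s => h s)).
  { intros h Hh. split; [|exact Logic.I]. intros t s It Is.
    now apply continuity_2d_pt_snd_of, Hh. }
  apply (Ck2_step I I' hI hI') with (fun _ _ => 0) (fun _ s => Derive p s).
  - apply Ck2_continuity with 0%nat, K. intros x Ix.
    apply (ex_derive_continuous p). eexists. now apply Hp.
  - intros t s It Is. apply @is_derive_const.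
  - intros t s It Is. now apply Hp.
  - now apply Ck2_const.
  - apply K. intros x Ix. now apply Hp.
Qed.

(** The divergence of the field f (p, q) has integral zero. *)
Lemma double_integral_by_parts (p q : R -> R) (f : R -> R -> R) :
  C1_on I p -> C1_on I' q -> Ck2 1 I I' f -> supported_in t0 t1 s0 s1 f ->
  double_integral (fun t s => - (p t * D1 f t s + q s * D2 f t s)) t0 t1 s0 s1
  = double_integral (fun t s => f t s * (Derive p t + Derive q s)) t0 t1 s0 s1.
Proof using hI hI' Ht0 Ht1 Ht Hs0 Hs1 Hs.
  intros Hp Hq Hf H0.
  assert (Cp := C1_on_Ck2_fst p Hp). assert (Cq := C1_on_Ck2_snd q Hq).
  set (P := fun t s => p t * f t s). set (Q := fun t s => q s * f t s).
  assert (CP : Ck2 1 I I' P) by now apply (Ck2_mult I I' hI hI' 1 (fun t _ => p t)).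
  assert (CQ : Ck2 1 I I' Q) by now apply (Ck2_mult I I' hI hI' 1 (fun _ s => q s)).
  assert (EP := double_integral_D1_supported P CP
    ltac:(intros t s H; unfold P; rewrite (H0 t s H); ring)).
  assert (EQ := double_integral_D2_supported Q CQ
    ltac:(intros t s H; unfold Q; rewrite (H0 t s H); ring)).
  assert (KP := Ck2_continuity 0 I I' _ (Ck2_D1 0 I I' P CP)).
  assert (KQ := Ck2_continuity 0 I I' _ (Ck2_D2 0 I I' Q CQ)).
  assert (Plus := double_integral_plus I I' hI hI' t0 t1 s0 s1 Ht0 Ht1 Ht Hs0 Hs1 Hs).
  set (A := fun t s => - (p t * D1 f t s + q s * D2 f t s)).
  assert (KA : forall t s, I t -> I' s -> continuity_2d_pt A t s).
  { intros t s It Is. apply continuity_2d_pt_opp, continuity_2d_pt_plus;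
    apply continuity_2d_pt_mult.
    - exact (Ck2_continuity 1 I I' _ Cp t s It Is).
    - exact (Ck2_continuity 0 I I' _ (Ck2_D1 0 I I' f Hf) t s It Is).
    - exact (Ck2_continuity 1 I I' _ Cq t s It Is).
    - exact (Ck2_continuity 0 I I' _ (Ck2_D2 0 I I' f Hf) t s It Is). }
  rewrite (double_integral_ext I I' hI hI' t0 t1 s0 s1 Ht0 Ht1 Ht Hs0 Hs1 Hs
    (fun t s => f t s * (Derive p t + Derive q s))
    (fun t s => A t s + (D1 P t s + D2 Q t s))).
  - rewrite Plus, Plus, EP, EQ; auto; [ring|].
    intros t s It Is. apply continuity_2d_pt_plus; auto.
  - intros t s It Is.
    assert (E1 : D1 P t s = Derive p t * f t s + p t * D1 f t s).
    { apply is_derive_unique, (is_derive_mult p (fun x => f x s)); [now apply Hp| |].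
      - exact (Ck2_derive1 0 I I' f Hf t s It Is).
      - apply Rmult_comm. }
    assert (E2 : D2 Q t s = Derive q s * f t s + q s * D2 f t s).
    { apply is_derive_unique, (is_derive_mult q (fun y => f t y)); [now apply Hq| |].
      - exact (Ck2_derive2 0 I I' f Hf t s It Is).
      - apply Rmult_comm. }
    rewrite E1, E2. unfold A. ring.
Qed.

End Parts.

(** * Smooth bumps and the fundamental lemma of the calculus of variations *)

(** The factor x^(-n) is there because the derivatives of exp(-1/x) are combinations
    of such functions: all are proved smooth together. *)
Definition flat (n : nat) (x : R) : R :=
  if Rlt_dec 0 x then (/ x) ^ n * exp (- / x) else 0.

Lemma flat_pos (n : nat) (x : R) : 0 < x -> 0 < flat n x.
Proof.
  intros Hx. unfold flat. destruct (Rlt_dec 0 x); [|lra].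
  apply Rmult_lt_0_compat; [|apply exp_pos]. apply pow_lt, Rinv_0_lt_compat, Hx.
Qed.

Lemma flat_nonpos (n : nat) (x : R) : x <= 0 -> flat n x = 0.
Proof. intros Hx. unfold flat. destruct (Rlt_dec 0 x); [lra|reflexivity]. Qed.

Lemma flat_succ (n : nat) (x : R) : flat n x = x * flat (S n) x.
Proof.
  unfold flat. destruct (Rlt_dec 0 x); [|ring]. simpl. field. lra.
Qed.

Lemma pow_le_fact_exp (n : nat) (y : R) : 0 <= y -> y ^ n <= INR (fact n) * exp y.
Proof.
  intros Hy. revert y Hy. induction n as [|n IH]; intros y Hy.
  - simpl. generalize (exp_ineq1_le y). lra.
  - destruct (MVT_gen (fun x => INR (fact (S n)) * exp x - x ^ S n) 0 y
      (fun x => INR (fact (S n)) * exp x - INR (S n) * x ^ n)) as [c [Hc E]].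
    + intros x _. auto_derive; [exact Logic.I|].
      change (INR (fact (S n)) * (1 * exp x) + - (1 * (INR (S n) * x ^ n))
              = INR (fact (S n)) * exp x - INR (S n) * x ^ n). ring.
    + intros x _. apply continuity_pt_filterlim.
      apply (ex_derive_continuous (fun x => INR (fact (S n)) * exp x - x ^ S n)).
      auto_derive. exact Logic.I.
    + rewrite Rmin_left, Rmax_right in Hc by exact Hy.
      assert (Hn : 0 <= INR (fact (S n)) * exp c - INR (S n) * c ^ n).
      { rewrite fact_simpl, mult_INR. generalize (IH c (proj1 Hc)) (pos_INR (S n)). nra. }
      rewrite exp_0, pow_i in E by lia.
      assert (0 <= INR (fact (S n))) by apply pos_INR.
      assert (0 <= (INR (fact (S n)) * exp c - INR (S n) * c ^ n) * (y - 0))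
        by (apply Rmult_le_pos; lra).
      lra.
Qed.

Lemma flat_bounded (n : nat) (x : R) : 0 <= flat n x <= INR (fact n).
Proof.
  destruct (Rlt_dec 0 x) as [Hx|Hx].
  - split; [now apply Rlt_le, flat_pos|].
    unfold flat. destruct (Rlt_dec 0 x); [|lra].
    assert (Hy : 0 <= / x) by now apply Rlt_le, Rinv_0_lt_compat.
    apply Rmult_le_reg_r with (exp (/ x)); [apply exp_pos|].
    rewrite Rmult_assoc, <- exp_plus, Rplus_opp_l, exp_0, Rmult_1_r.
    now apply pow_le_fact_exp.
  - rewrite flat_nonpos by lra. split; [lra|apply pos_INR].
Qed.

(** Away from 0 this is calculus. At 0 the difference quotient of [flat n] is
    [flat (S n)], which is x times the bounded function [flat (S (S n))]. *)
Lemma is_derive_flat (n : nat) (x : R) :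
  is_derive (flat n) x (- INR n * flat (S n) x + flat (S (S n)) x).
Proof.
  destruct (total_order_T 0 x) as [[Hx|Hx]|Hx].
  - apply is_derive_ext_loc with (fun x => (/ x) ^ n * exp (- / x)).
    + generalize (open_gt 0 x Hx). apply filter_imp. intros y Hy.
      unfold flat. now destruct (Rlt_dec 0 y).
    + assert (E : - INR n * flat (S n) x + flat (S (S n)) x
        = INR n * (- / x ^ 2) * (/ x) ^ pred n * exp (- / x)
          + (/ x) ^ n * (/ x ^ 2 * exp (- / x))).
      { unfold flat. destruct (Rlt_dec 0 x); [|lra]. destruct n; simpl; field; lra. }
      rewrite E. auto_derive; [lra|]. simpl. field. lra.
  - subst x. rewrite !flat_nonpos by lra.
    apply is_derive_Reals. intros e He.
    assert (HB := flat_bounded (S (S n))). assert (HM := pos_INR (fact (S (S n)))).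
    revert HB HM. generalize (INR (fact (S (S n)))). intros M HB HM.
    assert (Hd : 0 < e / (M + 1)) by (apply Rdiv_lt_0_compat; lra).
    exists (mkposreal _ Hd). simpl. intros h Hh Hhd.
    rewrite Rplus_0_l, (flat_nonpos n 0), (flat_succ n h), (flat_succ (S n) h) by lra.
    replace ((h * (h * flat (S (S n)) h) - 0) / h - (- INR n * 0 + 0))
      with (h * flat (S (S n)) h) by (field; exact Hh).
    destruct (HB h) as [B1 B2].
    rewrite Rabs_mult, (Rabs_pos_eq (flat _ h)) by exact B1.
    apply Rle_lt_trans with (Rabs h * M).
    + apply Rmult_le_compat_l; [apply Rabs_pos|exact B2].
    + apply Rmult_lt_compat_r with (r := M + 1) in Hhd; [|lra].
      replace (e / (M + 1) * (M + 1)) with e in Hhd by (field; lra).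
      generalize (Rabs_pos h). lra.
  - rewrite !flat_nonpos by lra.
    replace (- INR n * 0 + 0) with 0 by ring.
    apply is_derive_ext_loc with (fun _ => 0); [|apply @is_derive_const].
    generalize (open_lt 0 x Hx). apply filter_imp. intros y Hy.
    rewrite flat_nonpos by lra. reflexivity.
Qed.

Lemma flat_smooth (k n : nat) (x : R) : ex_derive_n (flat n) k x.
Proof.
  revert n x. induction k as [k IH] using (well_founded_induction Wf_nat.lt_wf).
  intros n x. destruct k as [|k]; [exact Logic.I|].
  assert (E : forall y, Derive (flat n) y
                        = - INR n * flat (S n) y + flat (S (S n)) y).
  { intros y. apply is_derive_unique, is_derive_flat. }
  destruct k as [|k]; [eexists; apply is_derive_flat|].
  assert (H : ex_derive_n (Derive (flat n)) (S k) x).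
  { apply ex_derive_n_ext with (fun y => - INR n * flat (S n) y + flat (S (S n)) y).
    { intros y. now rewrite E. }
    apply ex_derive_n_plus; apply filter_forall; intros y j Hj.
    - apply ex_derive_n_scal_l, IH. lia.
    - apply IH. lia. }
  simpl in H |- *. revert H. apply ex_derive_ext. intros y.
  change (Derive (Derive_n (flat n) k) y) with (Derive_n (flat n) (1 + k) y).
  rewrite PeanoNat.Nat.add_comm. apply (Derive_n_comp (flat n) k 1).
Qed.

(** The arguments are written as sums, the form in which the derivatives of translates
    and reflections are available. *)
Definition bump (a b x : R) : R := flat 0 (x + - a) * flat 0 (- x + b).

Lemma bump_zero (a b x : R) : ~ (a <= x <= b) -> bump a b x = 0.
Proof.
  intros H. unfold bump. destruct (Rlt_dec x a).
  - rewrite (flat_nonpos 0 (x + - a)) by lra. ring.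
  - rewrite (flat_nonpos 0 (- x + b)) by lra. ring.
Qed.

Lemma bump_pos (a b x : R) : a < x < b -> 0 < bump a b x.
Proof. intros H. apply Rmult_lt_0_compat; apply flat_pos; lra. Qed.

Lemma flat_shift_smooth (I : R -> Prop) (a : R) : smooth_on I (fun x => flat 0 (x + - a)).
Proof. intros n x _. apply ex_derive_n_comp_trans, flat_smooth. Qed.

Lemma flat_reflect_smooth (I : R -> Prop) (b : R) :
  smooth_on I (fun x => flat 0 (- x + b)).
Proof.
  intros n x _.
  apply (ex_derive_n_comp_opp (fun y => flat 0 (y + b))).
  apply filter_forall. intros y k _. apply ex_derive_n_comp_trans, flat_smooth.
Qed.

Lemma bump_continuous (a b x : R) : continuous (bump a b) x.
Proof.
  apply (continuous_mult (fun x => flat 0 (x + - a)) (fun x => flat 0 (- x + b))).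
  - apply (ex_derive_continuous (fun x => flat 0 (x + - a))).
    exact (flat_shift_smooth (fun _ => True) a 1%nat x Logic.I).
  - apply (ex_derive_continuous (fun x => flat 0 (- x + b))).
    exact (flat_reflect_smooth (fun _ => True) b 1%nat x Logic.I).
Qed.

Lemma smooth2_bump (I I' : R -> Prop) (a b c d : R) :
  is_open_interval I -> is_open_interval I' ->
  smooth2 I I' (fun t s => bump a b t * bump c d s).
Proof.
  intros hI hI' n.
  assert (Mu := Ck2_mult I I' hI hI' n).
  apply (Mu (fun t _ => bump a b t) (fun _ s => bump c d s)).
  - exact (Mu _ _ (Ck2_fst I I' hI hI' n _ (flat_shift_smooth I a))
                  (Ck2_fst I I' hI hI' n _ (flat_reflect_smooth I b))).
  - exact (Mu _ _ (Ck2_snd I I' hI hI' n _ (flat_shift_smooth I' c))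
                  (Ck2_snd I I' hI hI' n _ (flat_reflect_smooth I' d))).
Qed.

(** Where g is positive, so is its integral against a bump on a small interval; the
    negative case is the positive one for - g. *)
Lemma fundamental_lemma (I : R -> Prop) (g : R -> R) :
  is_open_interval I -> (forall x, I x -> continuous g x) ->
  (forall a b, I a -> I b -> a < b -> RInt (fun x => bump a b x * g x) a b = 0) ->
  forall x, I x -> g x = 0.
Proof.
  intros hI.
  assert (Hpos : forall g : R -> R, (forall x, I x -> continuous g x) ->
    (forall a b, I a -> I b -> a < b -> RInt (fun x => bump a b x * g x) a b = 0) ->
    forall x, I x -> ~ 0 < g x).
  { clear g. intros g Hg H0 x Ix Hx.
    assert (L : locally x (fun y => I y /\ 0 < g y)).
    { apply filter_and; [now apply open_interval_locally|].
      apply (Hg x Ix). now apply open_gt. }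
    destruct L as [d Hd]. assert (Hdp := cond_pos d).
    assert (Hin : forall y, x - d / 2 <= y <= x + d / 2 -> I y /\ 0 < g y).
    { intros y Hy. apply Hd. change (Rabs (y - x) < d). apply Rabs_lt_between'. lra. }
    assert (E := H0 (x - d / 2) (x + d / 2) ltac:(apply Hin; lra)
                  ltac:(apply Hin; lra) ltac:(lra)).
    apply (Rlt_irrefl 0). rewrite <- E at 2.
    apply RInt_gt_0; [lra| |].
    - intros y Hy. apply Rmult_lt_0_compat; [now apply bump_pos|apply Hin; lra].
    - intros y Hy. apply (continuous_mult (bump _ _) g); [apply bump_continuous|].
      apply Hg, Hin, Hy. }
  intros Hg H0 x Ix.
  assert (N1 := Hpos g Hg H0 x Ix).
  assert (N2 := Hpos (fun x => - g x)).
  destruct (Rtotal_order (g x) 0) as [H|[H|H]]; [|exact H|contradiction].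
  exfalso. apply N2 with x; [| |exact Ix|lra].
  - intros y Iy. apply (continuous_opp (V := R_NormedModule) g). now apply Hg.
  - intros a b Ia Ib Hab.
    rewrite (RInt_ext (V := R_CompleteNormedModule) _ (fun x => opp (bump a b x * g x))).
    2:{ intros y _. unfold opp. simpl. ring. }
    rewrite (RInt_opp (V := R_CompleteNormedModule)).
    + rewrite H0 by assumption. apply Ropp_0.
    + apply (ex_RInt_continuous (V := R_CompleteNormedModule)).
      rewrite Rmin_left, Rmax_right by lra. intros y Hy.
      apply (continuous_mult (bump _ _) g); [apply bump_continuous|].
      now apply Hg, (open_interval_between I a b).
Qed.

(** For fixed bump in s, the fundamental lemma in t shows that the inner integral
    vanishes for each t; then the fundamental lemma in s applies. *)
Lemma double_fundamental_lemma (I I' : R -> Prop) (u v : R -> R) :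
  is_open_interval I -> is_open_interval I' ->
  (forall t, I t -> continuous u t) -> (forall s, I' s -> continuous v s) ->
  (forall t0 t1 s0 s1, I t0 -> I t1 -> t0 < t1 -> I' s0 -> I' s1 -> s0 < s1 ->
     double_integral (fun t s => bump t0 t1 t * bump s0 s1 s * (u t + v s)) t0 t1 s0 s1
     = 0) ->
  forall t s, I t -> I' s -> u t + v s = 0.
Proof.
  intros hI hI' Hu Hv H0 t s It Is.
  assert (Hcv : forall t s, I' s -> continuous (fun y => u t + v y) s).
  { intros t' s' Is'. apply (continuous_plus (fun _ => u t') v); [apply continuous_const|].
    now apply Hv. }
  apply (fundamental_lemma I' (fun y => u t + v y) hI'); [now intros; apply Hcv| |exact Is].
  intros s0 s1 Is0 Is1 Hs.
  set (h := fun t s => bump s0 s1 s * (u t + v s)).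
  assert (Hh : forall t s, I t -> I' s -> continuity_2d_pt h t s).
  { intros x y Ix Iy. apply continuity_2d_pt_mult; [|apply continuity_2d_pt_plus].
    - apply (continuity_2d_pt_snd_of (bump s0 s1)), bump_continuous.
    - now apply (continuity_2d_pt_fst_of u), Hu.
    - now apply (continuity_2d_pt_snd_of v), Hv. }
  apply (fundamental_lemma I (fun x => RInt (h x) s0 s1) hI); [| |exact It].
  - intros x Ix. apply (continuous_inner_RInt I I' hI hI' s0 s1); auto. lra.
  - intros t0 t1 It0 It1 Ht. rewrite <- (H0 t0 t1 s0 s1) by assumption.
    apply RInt_ext. rewrite Rmin_left, Rmax_right by lra. intros x Hx.
    rewrite <- (RInt_scal (V := R_CompleteNormedModule)).
    + apply RInt_ext. intros y _. unfold scal, h. simpl. unfold mult. simpl. ring.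
    + apply (inner_ex_RInt I I' hI' s0 s1); auto; [lra|].
      apply (open_interval_between I t0 t1); auto; lra.
Qed.

(** * Affine curvatures *)

Lemma open_interval_inhabited (I : R -> Prop) :
  is_open_interval I -> exists x, I x.
Proof.
  intros [a [b [Hab H]]].
  assert (K : exists x : R, Rbar_lt a x /\ Rbar_lt x b).
  { destruct a as [a| |]; destruct b as [b| |]; simpl in Hab; try contradiction.
    - exists ((a + b) / 2). simpl. lra.
    - exists (a + 1). simpl. lra.
    - exists (b - 1). simpl. lra.
    - exists 0. simpl. auto. }
  destruct K as [x Hx]. exists x. now apply H.
Qed.

Lemma affine_of_constant_derivative (I : R -> Prop) (k : R -> R) (a : R) :
  is_open_interval I -> (forall x, I x -> is_derive k x a) ->
  exists b, forall x, I x -> k x = a * x + b.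
Proof.
  intros hI Hk. destruct (open_interval_inhabited I hI) as [x0 Hx0].
  exists (k x0 - a * x0). intros x Ix.
  assert (Hin : forall c, Rmin x0 x <= c <= Rmax x0 x -> I c).
  { intros c Hc. apply (open_interval_between I (Rmin x0 x) (Rmax x0 x)); auto.
    - unfold Rmin. now destruct (Rle_dec x0 x).
    - unfold Rmax. now destruct (Rle_dec x0 x). }
  destruct (MVT_gen k x0 x (fun _ => a)) as [c [_ E]].
  - intros c Hc. apply Hk, Hin. lra.
  - intros c Hc. apply continuity_pt_filterlim, (ex_derive_continuous k).
    eexists. now apply Hk, Hin.
  - lra.
Qed.

Lemma Derive_affine (I : R -> Prop) (k : R -> R) (a b x : R) :
  is_open_interval I -> (forall x, I x -> k x = a * x + b) -> I x -> Derive k x = a.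
Proof.
  intros hI Hk Ix. apply is_derive_unique.
  apply is_derive_ext_loc with (fun x => a * x + b).
  - generalize (open_interval_locally I x hI Ix). apply filter_imp.
    intros y Iy. symmetry. now apply Hk.
  - auto_derive; [exact Logic.I|ring].
Qed.

Theorem theorem4p4 (I1 I2 : R -> Prop) (gamma1 gamma2 alpha1 alpha2 : R -> C)
  (hI1 : is_open_interval I1) (hI2 : is_open_interval I2)
  (hgamma : unit_legendre_S3 I1 gamma1 gamma2)
  (halpha : unit_legendre_H31 I2 alpha1 alpha2)
  (hphi : immersion I2 I1 (product_surface alpha1 alpha2 gamma1 gamma2)) :
  hamiltonian_minimal I2 I1 (product_surface alpha1 alpha2 gamma1 gamma2) <->
  exists a b c : R,
    (forall t, I2 t -> curvature_H31 alpha1 alpha2 t = a * t + b) /\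
    (forall s, I1 s -> curvature_S3 gamma1 gamma2 s = - a * s + c).
Proof.
  assert (hg := legendre_S3 _ _ _ hgamma). assert (ha := legendre_H31 _ _ _ halpha).
  set (p := curvature (-1) alpha1 alpha2). set (q := curvature 1 gamma1 gamma2).
  assert (Hp : C1_on I2 p).
  { intros t It. exact (legendre_curvature_smooth (-1) I2 hI2 _ _ ha t It). }
  assert (Hq : C1_on I1 q).
  { intros s Is. exact (legendre_curvature_smooth 1 I1 hI1 _ _ hg s Is). }
  assert (Hvar : forall f t0 t1 s0 s1, I2 t0 -> I2 t1 -> t0 <= t1 ->
    I1 s0 -> I1 s1 -> s0 <= s1 -> smooth2 I2 I1 f -> supported_in t0 t1 s0 s1 f ->
    is_derive (fun e => area (variation (product_surface alpha1 alpha2 gamma1 gamma2)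
      (hamiltonian_field (product_surface alpha1 alpha2 gamma1 gamma2) f) e) t0 t1 s0 s1)
      0 (double_integral (fun t s => f t s * (Derive p t + Derive q s)) t0 t1 s0 s1)).
  { intros f t0 t1 s0 s1 Ht0 Ht1 Ht Hs0 Hs1 Hs Hf H0.
    rewrite <- (double_integral_by_parts I2 I1) by (auto; exact (Hf 1%nat)).
    now apply (product_first_variation I2 I1). }
  split.
  - intros [_ [_ Hmin]].
    assert (Hsum : forall t s, I2 t -> I1 s -> Derive p t + Derive q s = 0).
    { apply double_fundamental_lemma; auto.
      - intros t It. now apply Hp.
      - intros s Is. now apply Hq.
      - intros t0 t1 s0 s1 Ht0 Ht1 Ht Hs0 Hs1 Hs.
        set (f := fun t s => bump t0 t1 t * bump s0 s1 s).
        assert (Sf : smooth2 I2 I1 f) by now apply smooth2_bump.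
        assert (Zf : supported_in t0 t1 s0 s1 f).
        { intros t s H. unfold f.
          destruct (Classical_Prop.not_and_or _ _ H) as [H'|H'].
          - rewrite (bump_zero t0 t1 t H'). ring.
          - rewrite (bump_zero s0 s1 s H'). ring. }
        apply Rlt_le in Ht. apply Rlt_le in Hs.
        assert (E1 := Hvar f t0 t1 s0 s1 Ht0 Ht1 Ht Hs0 Hs1 Hs Sf Zf).
        assert (E2 := Hmin f t0 t1 s0 s1 Ht0 Ht1 Ht Hs0 Hs1 Hs Sf Zf).
        apply is_derive_unique in E1. apply is_derive_unique in E2.
        rewrite E1 in E2. exact E2. }
    destruct (open_interval_inhabited I1 hI1) as [s' Is'].
    destruct (open_interval_inhabited I2 hI2) as [t' It'].
    assert (Ep : forall t, I2 t -> Derive p t = - Derive q s').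
    { intros t It. generalize (Hsum t s' It Is'). lra. }
    assert (Eq : forall s, I1 s -> Derive q s = - - Derive q s').
    { intros s Is. generalize (Hsum t' s It' Is) (Hsum t' s' It' Is'). lra. }
    destruct (affine_of_constant_derivative I2 p (- Derive q s') hI2) as [b Hb].
    { intros t It. rewrite <- (Ep t It). now apply Hp. }
    destruct (affine_of_constant_derivative I1 q (- - Derive q s') hI1) as [c Hc].
    { intros s Is. rewrite <- (Eq s Is). now apply Hq. }
    exists (- Derive q s'), b, c. split.
    + intros t It. rewrite curvature_H31_eq. now apply Hb.
    + intros s Is. rewrite curvature_S3_eq. now apply Hc.
  - intros [a [b [c [Ha Hc]]]].
    split; [exact hphi|]. split.
    { intros t s It Is. now apply (product_hermitian_orthogonal I2 I1). }
    intros f t0 t1 s0 s1 Ht0 Ht1 Ht Hs0 Hs1 Hs Hf H0.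
    replace 0 with (double_integral (fun t s => f t s * (Derive p t + Derive q s)) t0 t1 s0 s1)
      at 2; [now apply Hvar|].
    transitivity (double_integral (fun _ _ => 0) t0 t1 s0 s1).
    + apply (double_integral_ext I2 I1); auto. intros t s It Is.
      rewrite (Derive_affine I2 p a b), (Derive_affine I1 q (- a) c); auto.
      * ring.
      * intros x Ix. unfold q. rewrite <- curvature_S3_eq. now apply Hc.
      * intros x Ix. unfold p. rewrite <- curvature_H31_eq. now apply Ha.
    + unfold double_integral. rewrite !RInt_const. unfold scal. simpl.
      unfold mult. simpl. ring.
Qed.
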